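(* Let $n\ge 2$, let $\Omega\subseteq\mathbb{R}^n$ be a bounded open set with $|\partial\Omega|<+\infty$, and let $x_0\in\Omega$. If $\partial\Omega$ is Lipschitz flat at a point $z\in T(\partial\Omega,x_0)$, then $$S_z(\partial\Omega,x_0)\leq 1.$$
   Context: Notation: $\sigma$ is the $(n-1)$-dimensional Hausdorff measure in $\mathbb{R}^n$, $|\partial\Omega|$ denotes the $(n-1)$-Hausdorff measure of the topological boundary, $\omega_n$ is the Lebesgue measure of the unit ball of $\mathbb{R}^n$, $B(x,\rho)$ is the open Euclidean ball. Touching set: $T(\partial\Omega,x_0):=\{z\in\partial\Omega: |x_0-z|=\mathrm{dist}(\partial\Omega,x_0)\}$. Spherical flatness index: let $\Omega$ be open with every compact subset of $\partial\Omega$ of finite $(n-1)$-Hausdorff measure, $x_0\in\Omega$, $z\in T(\partial\Omega,x_0)$, $r:=|z-x_0|$. Then $$S_z(\partial\Omega,x_0):=\frac{2}{n\omega_n r}\liminf_{R\searrow0}\left(\liminf_{\alpha\to z,\ \alpha\notin\overline\Omega}\int_{\partial\Omega\cap B(z,R)}\frac{\langle\alpha-x,\alpha-x_0\rangle}{|x-\alpha|^n}\,d\sigma(x)\right)\in[-\infty,+\infty].$$ Lipschitz flatness: split $\mathbb{R}^n=\mathbb{R}^{n-1}\times\mathbb{R}$ and write $z=(z',z_n)$ with $z'=(z_1,\dots,z_{n-1})$. For $R>0$ and $-\infty<a<z_n<b<+\infty$ put $\widehat B_R(z'):=\{y\in\mathbb{R}^{n-1}: |y-z'|<R\}$ and $U_R(a,b):=\widehat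 B_R(z')\times(a,b)$. Let $\Omega\subseteq\mathbb{R}^n$ be open and $z\in\partial\Omega$. $\partial\Omega$ is Lipschitz flat at $z$ if there exists a function $\psi:\widehat B_R(z')\to(a,b)$, with $R>0$ and $-\infty<a<z_n<b<+\infty$, such that: (i) $\psi$ is Lipschitz, differentiable, and $\nabla\psi(z'+t\xi)\to\nabla\psi(z')$ as $t\to0$ for almost every $\xi\in\mathbb{R}^{n-1}$; (ii) $\partial\Omega\cap U_R(a,b)=\{(y,\psi(y)): y\in\widehat B_R(z')\}$; (iii) $\Omega\cap U_R(a,b)=\{(y,t): y\in\widehat B_R(z'),\ a<t<\psi(y)<b\}$. *)

(* Defs.v *)
From HB Require Import structures.
From mathcomp Require Import all_boot all_order all_algebra.
From mathcomp Require Import all_classical all_reals all_analysis.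

Set Implicit Arguments.
Unset Strict Implicit.
Unset Printing Implicit Defensive.

Import Order.TTheory GRing.Theory Num.Theory.
Import numFieldNormedType.Exports.

Local Open Scope classical_set_scope.
Local Open Scope ring_scope.

(* The library norm on 'rV[R]_n is the sup norm, so the Euclidean structure
   is introduced separately; both norms induce the library topology. *)
Section euclidean.
Variables (R : realType) (n : nat).
Implicit Types (x y z : 'rV[R]_n) (A : set 'rV[R]_n).

Definition edot x y : R := \sum_(i < n) x 0 i * y 0 i.

Definition enorm x : R := Num.sqrt (edot x x).

Definition eball z (r : R) : set 'rV[R]_n := [set y | enorm (y - z) < r].

(* Since ereal_sup set0 = -oo, the diameter of the empty set is -oo. *)
Definition ediam A : \bar R :=
  ereal_sup [set (enorm (p.1 - p.2))%:E | p in A `*` A].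

Definition edist_to A x : R := inf [set enorm (x - w) | w in A].

Definition boundary A : set 'rV[R]_n := closure A `\` interior A.

Definition touching_set A x : set 'rV[R]_n :=
  [set z | A z /\ enorm (x - z) = edist_to A x].

Definition gradient (f : 'rV[R]_n -> R) y : 'rV[R]_n :=
  \row_i 'D_(delta_mx 0 i) f y.

(* The corners (ab k).1 and (ab k).2 delimit the k-th box of a cover. *)
Definition box_cover A : set (nat -> 'rV[R]_n * 'rV[R]_n) :=
  [set ab : nat -> 'rV[R]_n * 'rV[R]_n |
     (forall k i, (ab k).1 0 i <= (ab k).2 0 i) /\
     A `<=` \bigcup_k
       [set x : 'rV[R]_n | forall i, (ab k).1 0 i <= x 0 i <= (ab k).2 0 i]].

(* Lebesgue outer measure on R^n; meant for n > 0, as R^0 has no box of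
   volume 0. *)
Definition lebesgue_outer A : \bar R :=
  ereal_inf [set (\sum_(k <oo)
      (\prod_(i < n) ((ab k).2 0 i - (ab k).1 0 i))%:E)%E | ab in box_cover A].

Definition lebesgue_ae (P : 'rV[R]_n -> Prop) :=
  lebesgue_outer [set x | ~ P x] = 0%E.

End euclidean.

Arguments eball {R n} z r.

Definition omega (R : realType) (n : nat) : R :=
  fine (lebesgue_outer (eball (0 : 'rV[R]_n) 1)).

Section hausdorff.
Variables (R : realType) (n s : nat).
Implicit Types A B : set 'rV[R]_n.
Local Open Scope ereal_scope.

(* The factor omega_s / 2^s is the normalization for which the s-dimensional
   Hausdorff measure of R^s is Lebesgue measure. *)
Definition hausdorff_gauge A : \bar R :=
  if A == set0 then 0 else (omega R s / 2 ^+ s)%:E * ediam A ^+ s.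

Definition diam_cover (delta : R) B : set ((set 'rV[R]_n)^nat) :=
  [set A | (forall k, ediam (A k) <= delta%:E) /\ B `<=` \bigcup_k A k].

Definition hausdorff_delta (delta : R) B : \bar R :=
  ereal_inf [set \sum_(k <oo) hausdorff_gauge (A k) | A in diam_cover delta B].

Definition hausdorff B : \bar R :=
  ereal_sup [set hausdorff_delta delta B | delta in [set d : R | (0 < d)%R]].

Let T := g_sigma_algebraType [set: set 'rV[R]_n].

Let gauge (delta : R) (A : set T) : \bar R :=
  if ediam A <= delta%:E then hausdorff_gauge A else +oo.

Let measurableTT (A : set T) : measurable A.
Proof. exact: sub_sigma_algebra. Qed.

Let enorm_ge0 (x : 'rV[R]_n) : (0 <= enorm x)%R.
Proof. exact: sqrtr_ge0. Qed.

Lemma lebesgue_outer_ge0 m (A : set 'rV[R]_m) : 0 <= lebesgue_outer A.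
Proof.
apply: le_ereal_inf_tmp => _ [ab [ab_le _] <-].
apply: nneseries_ge0 => k _ _; rewrite lee_fin; apply: prodr_ge0 => i _.
by rewrite subr_ge0.
Qed.

Lemma hausdorff_gauge_ge0 A : 0 <= hausdorff_gauge A.
Proof.
rewrite /hausdorff_gauge; case: (eqVneq A set0) => // /set0P[x Ax].
apply: mule_ge0.
  by rewrite lee_fin divr_ge0// ?exprn_ge0// fine_ge0// lebesgue_outer_ge0.
apply: expe_ge0; apply: (@le_trans _ _ (enorm (x - x))%:E).
  by rewrite lee_fin enorm_ge0.
by apply: ereal_sup_ubound; exists (x, x).
Qed.

Let gauge_ge0 delta (A : set T) : 0 <= gauge delta A.
Proof. by rewrite /gauge; case: ifP => // _; exact: hausdorff_gauge_ge0. Qed.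

Let gauge0 delta : gauge delta set0 = 0.
Proof.
rewrite /gauge /hausdorff_gauge eqxx; case: ifPn => //.
by rewrite /ediam setX0 image_set0 ereal_sup0 leNye.
Qed.

Let hausdorff_deltaE delta B :
  hausdorff_delta delta B = mu_ext (gauge delta) (B : set T).
Proof.
apply/eqP; rewrite eq_le; apply/andP; split.
  apply: le_ereal_inf_tmp => _ [A [_ BA] <-].
  have [dA|] := pselect (forall k, ediam (A k) <= delta%:E).
    apply: ereal_inf_lbound; exists A => //.
    by apply: eq_eseriesr => k _; rewrite /gauge dA.
  move=> /existsNP[k /negP dAk].
  rewrite (@eseries_pinfty _ _ _ k) ?leey//.
    by move=> i _; rewrite gt_eqF// (lt_le_trans _ (gauge_ge0 _ _))// ltNy0.
  by rewrite /gauge (negbTE dAk).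
apply: le_ereal_inf_tmp => _ [A [dA BA] <-].
apply: ereal_inf_lbound; exists A; first by split.
by apply: eq_eseriesr => k _; rewrite /gauge dA.
Qed.

Lemma hausdorff0 : hausdorff set0 = 0.
Proof.
apply/eqP; rewrite eq_le; apply/andP; split.
  apply: ge_ereal_sup => _ [d _ <-].
  by rewrite hausdorff_deltaE mu_ext0.
apply: (@le_trans _ _ (hausdorff_delta 1 set0)).
  by rewrite hausdorff_deltaE mu_ext_ge0.
by apply: ereal_sup_ubound; exists 1%R => //=.
Qed.

Lemma hausdorff_ge0 B : 0 <= hausdorff B.
Proof.
apply: (@le_trans _ _ (hausdorff_delta 1 B)).
  by rewrite hausdorff_deltaE mu_ext_ge0.
by apply: ereal_sup_ubound; exists 1%R => //=.
Qed.

Lemma le_hausdorff : {homo hausdorff : A B / A `<=` B >-> A <= B}.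
Proof.
move=> A B AB; apply: ge_ereal_sup => _ [d d0 <-].
apply: (@le_trans _ _ (hausdorff_delta d B)).
  by rewrite !hausdorff_deltaE; exact: le_mu_ext.
by apply: ereal_sup_ubound; exists d.
Qed.

Lemma hausdorff_sigma_subadditive : sigma_subadditive hausdorff.
Proof.
move=> A; apply: ge_ereal_sup => _ [d d0 <-].
rewrite hausdorff_deltaE.
apply: (le_trans (mu_ext_sigma_subadditive (gauge_ge0 d) _)).
apply: lee_nneseries => [i _ _|i _]; first exact: mu_ext_ge0.
by rewrite -hausdorff_deltaE; apply: ereal_sup_ubound; exists d.
Qed.

HB.instance Definition _ := isOuterMeasure.Build R 'rV[R]_n hausdorff
  hausdorff0 hausdorff_ge0 le_hausdorff hausdorff_sigma_subadditive.

(* The Caratheodory sigma-algebra contains the Borel sets. *)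
Let C : measurableType _ := caratheodory_type hausdorff.

Definition hausdorff_measure : set C -> \bar R := hausdorff.

Let hausdorff_measure0 : hausdorff_measure set0 = 0.
Proof. exact: hausdorff0. Qed.

Let hausdorff_measure_ge0 A : 0 <= hausdorff_measure A.
Proof. exact: hausdorff_ge0. Qed.

Let hausdorff_measure_sigma_additive : semi_sigma_additive hausdorff_measure.
Proof.
by move=> F mF tF mUF; exact: caratheodory_measure_sigma_additive.
Qed.

HB.instance Definition _ := isMeasure.Build _ _ _ hausdorff_measure
  hausdorff_measure0 hausdorff_measure_ge0 hausdorff_measure_sigma_additive.

End hausdorff.

Arguments hausdorff {R n} s B.
Arguments hausdorff_measure {R n} s.

Section flatness_index.
Variables (R : realType) (n : nat).
Implicit Types (Omega : set 'rV[R]_n) (x z alpha : 'rV[R]_n).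

Definition flatness_integral Omega x0 z (rho : R) alpha : \bar R :=
  (\int[hausdorff_measure n.-1]_(x in boundary Omega `&` eball z rho)
     (edot (alpha - x) (alpha - x0) / enorm (x - alpha) ^+ n)%:E)%E.

Definition flatness_index Omega x0 z : \bar R :=
  let r := enorm (z - x0) in
  ((2 / (n%:R * omega R n * r))%:E *
   limf_einf (fun rho : R =>
     limf_einf (flatness_integral Omega x0 z rho)
       (within (~` closure Omega) (nbhs z)))
     (0%R)^'+)%E.

End flatness_index.

(* R^(m + 1) is split as R^m * R along the block decomposition of 'rV_(m + 1):
   z' is lsubmx z, z_n is rsubmx z 0 0, and (y, t) is row_mx y t%:M. *)
Section lipschitz_flat.
Variables (R : realType) (m : nat).
Implicit Types (Omega : set 'rV[R]_(m + 1)) (z : 'rV[R]_(m + 1)).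

Definition lastc z : R := rsubmx z 0 0.

Definition cylinder (y0 : 'rV[R]_m) (rho a b : R) : set 'rV[R]_(m + 1) :=
  [set x | eball y0 rho (lsubmx x) /\ a < lastc x < b].

(* psi is a total function of which only the restriction to the open ball
   eball (lsubmx z) rho matters. *)
Definition lipschitz_flat Omega z := exists (rho a b : R) (psi : 'rV[R]_m -> R),
  let z' := lsubmx z in
  let B := eball z' rho in
  [/\ 0 < rho, a < lastc z < b & forall y, B y -> a < psi y < b] /\
  [/\ [lipschitz psi y | y in B],
      (forall y, B y -> differentiable psi y),
      lebesgue_ae (fun xi =>
        gradient psi (z' + t *: xi) @[t --> (0 : R)^'] --> gradient psi z'),
      boundary Omega `&` cylinder z' rho a b =
        [set row_mx y (psi y)%:M | y in B] &
      Omega `&` cylinder z' rho a b =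
        [set x | exists y t, [/\ x = row_mx y t%:M, B y, a < t < psi y
                                 & psi y < b]]].

End lipschitz_flat.

(* Main.v *)
Require Import Defs.
From HB Require Import structures.
From mathcomp Require Import all_boot all_order all_algebra.
From mathcomp Require Import all_classical all_reals all_analysis.
From mathcomp Require Import measurable_realfun.
From mathcomp Require Import ring lra.

Set Implicit Arguments.
Unset Strict Implicit.
Unset Printing Implicit Defensive.

Import Order.TTheory GRing.Theory Num.Theory.
Import numFieldNormedType.Exports.

Local Open Scope classical_set_scope.
Local Open Scope ring_scope.

(** Let [k] be the dimension of the boundary, [n = k + 1], let [r] be the
    distance from [x0] to [z], and [nu] the unit vector from [x0] to [z]. The
    index is a lower limit, so it suffices to bound the integral for a
    well-chosen sequence of points [alpha] tending to [z] from outside, namely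
    [alpha = z + t nu] with [t] small.

    The boundary stays outside of the ball of center [x0] and radius [r], and
    touches it at [z]; hence its tangent plane at [z] is orthogonal to [nu]
    ([touching_normal]), and [- (x - z).nu <= |x - z|^2 / (2 r)] for every
    boundary point [x]. The integrand is therefore at most
    [(r + t) (t + |x - z|^2 / (2 r)) / |x - alpha|^n], where [|x - alpha|] is
    almost [(t^2 + |h|^2)^(1/2)], [h] being the tangential part of [x - z]
    ([kernel_le]). The quadratic term contributes at most a multiple of the
    radius [R] of the domain of integration, which tends to [0] at the end. The
    main term, rescaled by [t], has as limit [r] times the integral of
    [(1 + |h|^2)^(-n/2)] over [R^k], that is [r n omega_n / 2], and the index is
    normalized by this number.

    The surface measure has to be compared with the Lebesgue measure of the
    tangent plane. The inequality between Hausdorff and Lebesgue measures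
    ([hausdorff_delta_le_lebesgue]) is used through Lipschitz maps
    ([hausdorff_lipschitz_image]). Where the gradient is close to its value [p]
    at [z], the graph is locally almost isometric to the tangent plane
    ([hausdorff_graph_flat]). By the assumption on the gradient along almost
    every ray, the other points at distance of order [t] occupy an arbitrarily
    small fraction of the tangent plane for suitable small [t]
    ([nonflat_small]); the crude Lipschitz bound suffices for them, and for the
    points that are far away with respect to [t].

    An integral is at most the sum, over an arbitrary cover of the domain, of
    upper bounds of the integrand times the outer measures of the pieces
    ([integral_le_cover]). The pieces are annuli with the geometric radii
    [geom_radius q i]; the resulting Riemann sum is transformed by summation by
    parts ([sum_geom_radius_le]) into the volume of a stack of cylinders
    inscribed in the ball of dimension [n] ([omega_ge_sum]). *)

(** * Euclidean geometry of row vectors *)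

Section euclidean_space.
Context {R : realType} {n : nat}.
Implicit Types (x y z : 'rV[R]_n) (a : R).

Lemma edotC x y : edot x y = edot y x.
Proof. by apply: eq_bigr => i _; rewrite mulrC. Qed.

Lemma edotDl x y z : edot (x + y) z = edot x z + edot y z.
Proof. by rewrite -big_split/=; apply: eq_bigr => i _; rewrite mxE mulrDl. Qed.

Lemma edotZl a x z : edot (a *: x) z = a * edot x z.
Proof. by rewrite mulr_sumr; apply: eq_bigr => i _; rewrite mxE mulrA. Qed.

Lemma edotNl x z : edot (- x) z = - edot x z.
Proof. by rewrite -scaleN1r edotZl mulN1r. Qed.

Lemma edotBl x y z : edot (x - y) z = edot x z - edot y z.
Proof. by rewrite edotDl edotNl. Qed.

Lemma edotDr x y z : edot x (y + z) = edot x y + edot x z.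
Proof. by rewrite edotC edotDl !(edotC x). Qed.

Lemma edotZr a x z : edot x (a *: z) = a * edot x z.
Proof. by rewrite edotC edotZl edotC. Qed.

Lemma edotNr x z : edot x (- z) = - edot x z.
Proof. by rewrite edotC edotNl edotC. Qed.

Lemma edotBr x y z : edot x (y - z) = edot x y - edot x z.
Proof. by rewrite edotDr edotNr. Qed.

Lemma edot0l x : edot 0 x = 0.
Proof. by rewrite -(scale0r 0) edotZl mul0r. Qed.

Lemma edot_ge0 x : 0 <= edot x x.
Proof. by apply: sumr_ge0 => i _; rewrite -expr2 sqr_ge0. Qed.

Lemma enorm_ge0 x : 0 <= enorm x.
Proof. exact: sqrtr_ge0. Qed.

Lemma enorm_sqr x : enorm x ^+ 2 = edot x x.
Proof. exact/sqr_sqrtr/edot_ge0. Qed.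

Lemma enorm0 : enorm (0 : 'rV[R]_n) = 0.
Proof. by rewrite /enorm edot0l sqrtr0. Qed.

Lemma enormZ a x : enorm (a *: x) = `|a| * enorm x.
Proof.
rewrite /enorm edotZl edotZr mulrA -expr2 sqrtrM ?sqr_ge0//.
by rewrite sqrtr_sqr.
Qed.

Lemma enormN x : enorm (- x) = enorm x.
Proof. by rewrite -scaleN1r enormZ normrN1 mul1r. Qed.

Lemma enormB x y : enorm (x - y) = enorm (y - x).
Proof. by rewrite -opprB enormN. Qed.

Lemma coord_le_enorm x i : `|x 0 i| <= enorm x.
Proof.
rewrite -(ler_pXn2r (n := 2)) ?nnegrE ?enorm_ge0//
  enorm_sqr real_normK ?num_real//.
rewrite /edot (bigD1 i)//= -expr2 lerDl.
by apply: sumr_ge0 => j _; rewrite -expr2 sqr_ge0.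
Qed.

Lemma enorm_eq0 x : enorm x = 0 -> x = 0.
Proof.
move=> x0; apply/rowP => i; rewrite mxE; apply/eqP; rewrite -normr_le0 -x0.
exact: coord_le_enorm.
Qed.

(** Cauchy-Schwarz, from the nonnegativity of the squared norm of
    [(y.y) x - (x.y) y]. *)
Lemma edot_le x y : `|edot x y| <= enorm x * enorm y.
Proof.
have [y0|ypos] := eqVneq (edot y y) 0.
  have -> : y = 0 by apply: enorm_eq0; rewrite /enorm y0 sqrtr0.
  by rewrite edotC edot0l normr0 enorm0 mulr0.
have {}ypos : 0 < edot y y by rewrite lt_neqAle eq_sym ypos edot_ge0.
rewrite -(ler_pXn2r (n := 2)) ?nnegrE ?mulr_ge0 ?enorm_ge0//.
rewrite exprMn !enorm_sqr real_normK ?num_real//.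
have := edot_ge0 (edot y y *: x - edot x y *: y).
rewrite !(edotBl, edotBr, edotZl, edotZr) (edotC y x) => h.
rewrite -subr_ge0 -(pmulr_rge0 _ ypos); apply: (le_trans h).
by rewrite le_eqVlt; apply/orP; left; apply/eqP; ring.
Qed.

Lemma enormD x y : enorm (x + y) <= enorm x + enorm y.
Proof.
rewrite -(ler_pXn2r (n := 2)) ?nnegrE ?addr_ge0 ?enorm_ge0//.
rewrite sqrrD !enorm_sqr !(edotDl, edotDr) (edotC y x).
have := le_trans (ler_norm _) (edot_le x y); lra.
Qed.

Lemma enorm_distD z x y : enorm (x - y) <= enorm (x - z) + enorm (z - y).
Proof. by rewrite (le_trans _ (enormD _ _))// addrA subrK. Qed.

Lemma mx_norm_le_enorm x : `|x| <= enorm x.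
Proof.
rewrite [leLHS](_ : _ = mx_norm x)//.
have [->|/mx_norm_neq0] := eqVneq (mx_norm x) 0; first exact: enorm_ge0.
by move=> -[[i j] ->]; rewrite (ord1 i); exact: coord_le_enorm.
Qed.

Lemma coord_le_mx_norm x i : `|x 0 i| <= `|x|.
Proof.
rewrite [leRHS]/Num.norm/= mx_normrE.
by rewrite (le_bigmax_cond _ (fun i : 'I_1 * 'I_n => `|x i.1 i.2|)
  (j := (0, i))).
Qed.

Lemma enorm_le_mx_norm x : enorm x <= n%:R * `|x|.
Proof.
rewrite -(ler_pXn2r (n := 2)) ?nnegrE ?mulr_ge0 ?enorm_ge0// enorm_sqr.
apply: (@le_trans _ _ (\sum_(i < n) `|x| ^+ 2)).
  apply: ler_sum => i _; rewrite -expr2 -[leLHS]real_normK ?num_real//.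
  by rewrite lerXn2r ?nnegrE//; exact: coord_le_mx_norm.
rewrite sumr_const card_ord exprMn -[leLHS]mulr_natl ler_wpM2r ?sqr_ge0//.
by rewrite -natrX ler_nat; case: (n) => // k; rewrite leq_pmulr.
Qed.

(** The topology of row vectors comes from the sup norm, which differs from the
    Euclidean norm by a factor of at most [n]. *)
Lemma nbhs_eball x (A : set 'rV[R]_n) :
  nbhs x A <-> exists2 e, 0 < e & eball x e `<=` A.
Proof.
split=> [/nbhs_ballP[e /= e0 eA]|[e e0 eA]].
  exists e => // y yx; apply: eA; rewrite -ball_normE/= -normrN opprB.
  exact: le_lt_trans (mx_norm_le_enorm _) yx.
apply/nbhs_ballP; exists (e / n.+1%:R); first by rewrite /= divr_gt0// ltr0n.
move=> y; rewrite -ball_normE/= => yx; apply: eA; rewrite /eball/= enormB.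
apply: le_lt_trans (enorm_le_mx_norm _) _.
apply: (@le_lt_trans _ _ (n.+1%:R * `|x - y|)).
  by rewrite ler_wpM2r// ler_nat.
by rewrite mulrC -ltr_pdivlMr ?ltr0n.
Qed.

Lemma open_eball x (e : R) : open (eball x e).
Proof.
rewrite openE => y yx; apply/nbhs_eball; exists (e - enorm (y - x)).
  by rewrite subr_gt0.
move=> w; rewrite /eball/= ltrBrDr => wy.
exact: le_lt_trans (enorm_distD y _ _) wy.
Qed.

End euclidean_space.

(** * Lebesgue outer measure *)

Section boxes.
Context {R : realType} {n : nat}.
Implicit Types (a b x : 'rV[R]_n).

Definition box a b : set 'rV[R]_n :=
  [set x | forall i, a 0 i <= x 0 i <= b 0 i].

Definition vol a b : R := \prod_(i < n) (b 0 i - a 0 i).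

Lemma vol_ge0 a b : (forall i, a 0 i <= b 0 i) -> 0 <= vol a b.
Proof. by move=> ab; apply: prodr_ge0 => i _; rewrite subr_ge0. Qed.

Lemma le_lebesgue_outer (A B : set 'rV[R]_n) :
  A `<=` B -> (lebesgue_outer A <= lebesgue_outer B)%E.
Proof.
move=> AB; apply: ereal_inf_le_tmp => _ [ab [ab_le Bab] <-].
by exists ab => //; split => // x /AB /Bab.
Qed.

(** Homotheties and translations carry covers by boxes to covers by boxes. *)
Lemma lebesgue_outer_affine (A : set 'rV[R]_n) (v : 'rV[R]_n) (c : R) : 0 < c ->
  (lebesgue_outer ((fun x => (v + c *: x)%R) @` A) <= (c ^+ n)%:E
    * lebesgue_outer A)%E.
Proof.
move=> c0; rewrite /lebesgue_outer -ereal_inf_pZl ?exprn_gt0//.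
apply: le_ereal_inf_tmp => _ [_ [ab [ab_le Aab] <-] <-].
rewrite -nneseriesZl; last first.
  by move=> k _; rewrite lee_fin; exact: vol_ge0.
apply: ereal_inf_lbound.
exists (fun k => (v + c *: (ab k).1, v + c *: (ab k).2)); last first.
  apply: eq_eseriesr => k _; rewrite -EFinM; congr EFin.
  have -> : c ^+ n = \prod_(i < n) c by rewrite prodr_const card_ord.
  rewrite -big_split/=; apply: eq_bigr => i _ /=.
  by rewrite !mxE; ring.
split=> [k i /=|_ [x Ax <-]].
  by rewrite !mxE lerD2l ler_pM2l.
have [k _ xk] := Aab _ Ax; exists k => // i; rewrite /= !mxE.
by rewrite !lerD2l !ler_pM2l.
Qed.

End boxes.

Section outer_measure_instance.
Context {R : realType} {n : nat}.
Implicit Types (a b x : 'rV[R]_n.+1) (A X : set 'rV[R]_n.+1).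
Local Open Scope ereal_scope.

Let T := g_sigma_algebraType [set: set 'rV[R]_n.+1].

Let gauge (A : set T) : \bar R := ereal_inf
  [set (vol ab.1 ab.2)%:E | ab in [set ab : 'rV[R]_n.+1 * 'rV[R]_n.+1 |
     (forall i, (ab.1 0 i <= ab.2 0 i)%R) /\ A `<=` box ab.1 ab.2]].

Let gauge_ge0 (A : set T) : 0 <= gauge A.
Proof.
apply: le_ereal_inf_tmp => _ [ab [ab_le _] <-].
by rewrite lee_fin; exact: vol_ge0.
Qed.

Let gauge0 : gauge set0 = 0.
Proof.
apply/eqP; rewrite eq_le gauge_ge0 andbT.
apply: ereal_inf_lbound; exists (0, 0)%R; first by split.
by rewrite /vol (bigD1 ord0)//= !mxE subrr mul0r.
Qed.

Let gauge_adherent A (e : R) : (0 < e)%R -> gauge A < +oo ->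
  exists2 ab : 'rV[R]_n.+1 * 'rV[R]_n.+1,
    (forall i, (ab.1 0 i <= ab.2 0 i)%R) /\ A `<=` box ab.1 ab.2 &
    (vol ab.1 ab.2)%:E <= gauge A + e%:E.
Proof.
move=> e0 Aoo; have /lb_ereal_inf_adherent : gauge A \is a fin_num.
  by rewrite fin_real// Aoo (lt_le_trans _ (gauge_ge0 _)).
by case/(_ _ e0) => _ [ab ? <-] ?; exists ab => //; exact/ltW.
Qed.

(** A cover by boxes amounts to a cover by arbitrary sets, each weighted by the
    least volume of a box around it. This puts [lebesgue_outer] within the
    general construction of outer measures, and gives its countable
    subadditivity. *)
Lemma lebesgue_outerE : @lebesgue_outer R n.+1 = mu_ext gauge.
Proof.
apply/funext => A; apply/eqP; rewrite eq_le; apply/andP; split; last first.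
  apply: le_ereal_inf_tmp => _ [ab [ab_le Aab] <-].
  apply: (@le_trans _ _ (\sum_(k <oo) gauge (box (ab k).1 (ab k).2))).
    apply: ereal_inf_lbound; exists (fun k => box (ab k).1 (ab k).2) => //.
    by split=> // k; exact: sub_sigma_algebra.
  apply: lee_nneseries => [k _ _|k _]; first exact: gauge_ge0.
  by apply: ereal_inf_lbound; exists (ab k) => //; split => // i; exact: ab_le.
apply: le_ereal_inf_tmp => _ [B [_ AB] <-].
have [[k Bk]|Boo] := pselect (exists k, gauge (B k) = +oo).
  rewrite (@eseries_pinfty _ _ _ k) ?leey// => i _.
  by rewrite gt_eqF// (lt_le_trans _ (gauge_ge0 _)).
apply/lee_addgt0Pr => e e0.
apply: le_trans (epsilon_trick xpredT (fun k => gauge_ge0 (B k)) (ltW e0)).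
have /choice[ab abP] k : exists ab : 'rV[R]_n.+1 * 'rV[R]_n.+1,
    [/\ forall i, (ab.1 0 i <= ab.2 0 i)%R, B k `<=` box ab.1 ab.2 &
    (vol ab.1 ab.2)%:E <= gauge (B k) + (e / (2 ^ k.+1)%:R)%:E].
  have := @gauge_adherent (B k) (e / (2 ^ k.+1)%:R)%R.
  case; first by rewrite divr_gt0// ltr0n expn_gt0.
    by rewrite ltey; apply: contra_not_neq Boo => ?; exists k.
  by move=> ab [] ? ? ?; exists ab.
apply: (@le_trans _ _ (\sum_(k <oo) (vol (ab k).1 (ab k).2)%:E)).
  apply: ereal_inf_lbound; exists ab => //; split => [k i|x /AB[k _ Bx]].
    by have [+ _ _] := abP k; exact.
  by exists k => //; have [_ + _] := abP k; exact.
apply: lee_nneseries => k *; last by have [] := abP k.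
by rewrite lee_fin; apply: vol_ge0; have [] := abP k.
Qed.

Let lebesgue_outer0 : @lebesgue_outer R n.+1 set0 = 0.
Proof. by rewrite lebesgue_outerE mu_ext0. Qed.

Let lebesgue_outer_sigma_subadditive : sigma_subadditive
  (@lebesgue_outer R n.+1).
Proof.
by rewrite lebesgue_outerE => F; exact: (mu_ext_sigma_subadditive gauge_ge0 F).
Qed.

HB.instance Definition _ := isOuterMeasure.Build R 'rV[R]_n.+1
  (@lebesgue_outer R n.+1) lebesgue_outer0 (@lebesgue_outer_ge0 R n.+1)
  (@le_lebesgue_outer R n.+1) lebesgue_outer_sigma_subadditive.

(** One box suffices as a cover, the others being degenerate. *)
Lemma lebesgue_outer_box a b : (forall i, (a 0 i <= b 0 i)%R) ->
  lebesgue_outer (box a b) <= (vol a b)%:E.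
Proof.
move=> ab; rewrite lebesgue_outerE.
apply: (@le_trans _ _ (gauge (box a b))); last first.
  by apply: ereal_inf_lbound; exists (a, b) => //; split.
apply: ereal_inf_lbound; exists
  (fun k => if k == 0%N then box a b : set 'rV[R]_n.+1 else set0).
  by split=> [k|x]; [exact: sub_sigma_algebra|exists 0%N].
rewrite nneseries_recl//.
rewrite [X in _ + X]eseries0 ?adde0 /=; first by [].
by move=> [|k] // _ _; exact: gauge0.
Qed.

(** The hyperplane [x i = c] cuts a box into two boxes, at the coordinate [c]
    clamped to the side of the box, and their volumes add up. *)
Lemma halfspace_caratheodory (i : 'I_n.+1) (c : R) :
  (@lebesgue_outer R n.+1).-caratheodory [set x | (x 0 i <= c)%R].
Proof.
apply: le_caratheodory_measurable => X.
apply: le_ereal_inf_tmp => _ [ab [ab_le Xab] <-].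
pose d k : R := Num.max ((ab k).1 0 i)%R (Num.min ((ab k).2 0 i)%R c).
pose l k : 'rV[R]_n.+1 := \row_j (if j == i then d k else ((ab k).2 0 j)%R).
pose r k : 'rV[R]_n.+1 := \row_j (if j == i then d k else ((ab k).1 0 j)%R).
have dP k : ((ab k).1 0 i <= d k <= (ab k).2 0 i)%R.
  by rewrite /d le_max lexx/= ge_max ab_le ge_min lexx.
have ll k j : ((ab k).1 0 j <= l k 0 j)%R.
  by rewrite mxE; case: eqP => [->|_]; [have /andP[] := dP k|].
have rr k j : (r k 0 j <= (ab k).2 0 j)%R.
  by rewrite mxE; case: eqP => [->|_]; [have /andP[] := dP k|].
have volD k : (vol (ab k).1 (ab k).2)%:E =
    (vol (ab k).1 (l k))%:E + (vol (r k) (ab k).2)%:E.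
  rewrite -EFinD; congr EFin.
  have volE (p q : 'rV[R]_n.+1) : vol p q =
    ((q 0 i - p 0 i) * \prod_(j | j != i) (q 0 j - p 0 j))%R by exact: bigD1.
  rewrite !volE.
  rewrite [X in _ = (_ * X + _)%R](eq_bigr
    (fun j => (ab k).2 0 j - (ab k).1 0 j)%R); last first.
    by move=> j /negbTE ji; rewrite mxE ji.
  rewrite [X in _ = (_ + _ * X)%R](eq_bigr
    (fun j => (ab k).2 0 j - (ab k).1 0 j)%R); last first.
    by move=> j /negbTE ji; rewrite mxE ji.
  rewrite !mxE eqxx.
  by ring.
rewrite (eq_eseriesr (g := fun k => (vol (ab k).1 (l k))%:E
  + (vol (r k) (ab k).2)%:E)); last first.
  by move=> k _; rewrite -volD.
rewrite nneseriesD; last 2 first.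
- by move=> k _ _; rewrite lee_fin; exact: vol_ge0.
- by move=> k _ _; rewrite lee_fin; exact: vol_ge0.
apply: leeD; apply: ereal_inf_lbound.
- exists (fun k => ((ab k).1, l k)) => //; split=> // x [/Xab[k _ xk] /= xc].
  exists k => //= j; have /andP[-> xb] := xk j; rewrite mxE.
  case: eqP => [ji|//]; subst j.
  by rewrite /d le_max le_min xb xc orbT.
- exists (fun k => (r k, (ab k).2)) => //; split=> // x [/Xab[k _ xk] /= /negP].
  rewrite -ltNge => xc.
  exists k => //= j; have /andP[xa ->] := xk j; rewrite mxE andbT.
  case: eqP => [ji|//]; subst j.
  by rewrite /d ge_max xa ge_min (ltW xc) orbT.
Qed.

End outer_measure_instance.

Section measurable_sets.
Context {R : realType} {n : nat}.
Implicit Types (x z : 'rV[R]_n.+1) (U : set 'rV[R]_n.+1).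

Let mu : {outer_measure set 'rV[R]_n.+1 -> \bar R} := @lebesgue_outer R n.+1.

(** An open set is the union of the half-open boxes with rational corners that
    it contains. *)
Lemma open_caratheodory U : open U -> (@lebesgue_outer R n.+1).-caratheodory U.
Proof.
move=> oU.
pose hbox (ab : 'rV[rat]_n.+1 * 'rV[rat]_n.+1) : set (caratheodory_type mu) :=
  [set x : 'rV[R]_n.+1 | forall i, ratr (ab.1 0 i) < x 0 i <= ratr (ab.2 0 i)].
have mhbox ab : measurable (hbox ab).
  pose h i (c : R) : set (caratheodory_type mu) :=
    [set x : 'rV[R]_n.+1 | x 0 i <= c].
  have mh i c : measurable (h i c) by exact: halfspace_caratheodory.
  rewrite (_ : hbox ab = \bigcap_(i in [set: 'I_n.+1])
      (h i (ratr (ab.2 0 i)) `\` h i (ratr (ab.1 0 i)))).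
    by apply: fin_bigcap_measurable => // i _; exact: measurableD.
  apply/seteqP; split=> [x xab i _|x xab i].
    by have /andP[ax xb] := xab i; split => //; apply/negP; rewrite -ltNge.
  by have [/= -> /negP] := xab i Logic.I; rewrite -ltNge => ->.
suff -> : U = \bigcup_(ab in [set ab | hbox ab `<=` U]) hbox ab.
  suff : measurable (\bigcup_(ab in [set ab | hbox ab `<=` U]) hbox ab) by [].
  rewrite bigcup_mkcond; apply: countable_bigcupT_measurable => [//|ab].
  by case: ifP.
apply/seteqP; split=> [x Ux|x [ab /= abU /abU]//].
have /nbhs_ballP[e /= e0 eU] : nbhs x U by exact: open_nbhs_nbhs.
have e20 : 0 < e / 2 by rewrite divr_gt0.
have /fin_all_exists[a aP] i : exists q : rat, ratr q \in `]x 0 i - e / 2,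
  x 0 i[.
  by apply: rat_in_itvoo; rewrite ltrBlDr ltrDl.
have /fin_all_exists[b bP] i : exists q : rat, ratr q \in `]x 0 i,
  x 0 i + e / 2[.
  by apply: rat_in_itvoo; rewrite ltrDl.
exists (\row_i a i, \row_i b i); last first.
  move=> i; rewrite /= !mxE.
  by move: (aP i) (bP i); rewrite !in_itv/= => /andP[_ ->] /andP[/ltW -> _].
move=> y yab; apply: eU; rewrite -ball_normE/=.
suff : `|x - y| <= e / 2 by move=> /le_lt_trans; apply; lra.
rewrite [leLHS]mx_normrE.
apply/bigmax_leP; split=> [|[i j] _]; first exact: ltW.
rewrite (ord1 i) !mxE/= ler_norml.
have := yab j; rewrite /= !mxE; move: (aP j) (bP j); rewrite !in_itv/=.
by move=> /andP[? ?] /andP[? ?] /andP[? ?]; apply/andP; split; lra.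
Qed.

Lemma lebesgue_outer_eball_unit_fin :
  lebesgue_outer (eball (0 : 'rV[R]_n.+1) 1) \is a fin_num.
Proof.
rewrite fin_real// (lt_le_trans _ (lebesgue_outer_ge0 _))//=.
apply: (@le_lt_trans _ _ (vol (const_mx (-1)) (const_mx 1 : 'rV[R]_n.+1))%:E).
  apply: le_trans (lebesgue_outer_box _).
    apply: le_lebesgue_outer => x; rewrite /eball/= subr0 => x1 i.
    by rewrite !mxE -ler_norml (le_trans (coord_le_enorm _ _))// ltW.
  by move=> i; rewrite !mxE; lra.
by rewrite ltry.
Qed.

Lemma omega_ge0 : 0 <= omega R n.+1.
Proof. exact/fine_ge0/lebesgue_outer_ge0. Qed.

(** The two inequalities come from the affine maps between the unit ball and the
    given one, in both directions. *)
Lemma lebesgue_outer_eball z (rho : R) : 0 <= rho ->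
  lebesgue_outer (eball z rho) = (omega R n.+1 * rho ^+ n.+1)%:E.
Proof.
rewrite le_eqVlt => /predU1P[<-|rho0].
  rewrite expr0n/= mulr0 (_ : eball z 0 = set0) ?outer_measure0//.
  by apply/seteqP; split=> // x; rewrite /eball/= ltNge enorm_ge0.
rewrite EFinM /omega fineK ?lebesgue_outer_eball_unit_fin// muleC.
apply/eqP; rewrite eq_le; apply/andP; split.
  apply: le_trans (lebesgue_outer_affine (eball 0 1) z rho0).
  apply: le_lebesgue_outer => x; rewrite /eball/= => xz.
  exists (rho^-1 *: (x - z)).
    by rewrite /eball/= subr0 enormZ gtr0_norm ?invr_gt0// mulrC ltr_pdivrMr//
      mul1r.
  by rewrite scalerA mulfV ?gt_eqF// scale1r addrC subrK.
rewrite -lee_pdivlMl ?exprn_gt0// -exprVn.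
have ri0 : 0 < rho^-1 by rewrite invr_gt0.
apply: le_trans (lebesgue_outer_affine (eball z rho) (- (rho^-1 *: z)) ri0).
apply: le_lebesgue_outer => x; rewrite /eball/= subr0 => x1.
exists (z + rho *: x).
  by rewrite /eball/= addrAC subrr add0r enormZ gtr0_norm// gtr_pMr.
by rewrite scalerDr scalerA mulVf ?gt_eqF// scale1r addKr.
Qed.

Lemma lebesgue_outer_annulus (rho1 rho2 : R) : 0 <= rho1 -> rho1 <= rho2 ->
  lebesgue_outer (eball (0 : 'rV[R]_n.+1) rho2 `\` eball 0 rho1) =
    (omega R n.+1 * (rho2 ^+ n.+1 - rho1 ^+ n.+1))%:E.
Proof.
move=> rho10 rho12.
have := open_caratheodory (@open_eball R n.+1 0 rho1) (eball 0 rho2).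
rewrite (_ : eball 0 rho2 `&` eball 0 rho1 = eball 0 rho1); last first.
  by apply/setIidPr => x; rewrite /eball/= => /lt_le_trans; exact.
rewrite !lebesgue_outer_eball ?(le_trans rho10)// setDE => /eqP.
rewrite addeC -sube_eq ?fin_num_adde_defl // => /eqP <-.
by rewrite -EFinB mulrBr.
Qed.

End measurable_sets.

(** * Hausdorff content is at most Lebesgue measure *)

Section cube_test.
Context {R : realType} {n : nat}.
Variable phi : {outer_measure set 'rV[R]_n.+1 -> \bar R}.
Variables (kappa s0 : R).
Hypotheses (kappa_ge0 : 0 <= kappa) (s0_gt0 : 0 < s0).
Hypothesis phi_cube : forall (c : 'rV[R]_n.+1) (s : R), 0 < s <= s0 ->
  (phi (box c (c + const_mx s)) <= (kappa * s ^+ n.+1)%:E)%E.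

Let outer_measure_bigcup_fin (I : finType) (F : I -> set 'rV[R]_n.+1) :
  (phi (\bigcup_i F i) <= \sum_i phi (F i))%E.
Proof.
rewrite (_ : \bigcup_i F i = \big[setU/set0]_(i : I) F i); last first.
  by rewrite -bigcup_seq; apply: eq_bigcupl; split=> i //= _;
    rewrite mem_index_enum.
elim/big_ind2 : _ => [|A x B y Ax By|//]; first by rewrite outer_measure0.
by rewrite (le_trans (outer_measureU2 _ _ _))// leeD.
Qed.

(** A box is covered by a grid of cubes of side [s] that exceeds it by at most
    [s] in each direction. *)
Let phi_box_grid (a b : 'rV[R]_n.+1) (s : R) : (forall i, a 0 i <= b 0 i) ->
  0 < s <= s0 ->
  (phi (box a b) <= (kappa * \prod_i (b 0 i - a 0 i + s))%:E)%E.
Proof.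
move=> ab /andP[sgt0 ss0].
pose N i := (Num.trunc ((b 0 i - a 0 i) / s)).+1.
pose M := \max_i N i.
pose F (i : 'I_n.+1) (j : 'I_M) : R := if (j < N i)%N then s else 0.
pose cube (f : {ffun 'I_n.+1 -> 'I_M}) := if [forall i, f i < N i]%N then
  box (\row_i (a 0 i + (f i)%:R * s))
    (\row_i (a 0 i + (f i)%:R * s) + const_mx s)
  else set0.
have l0 i : 0 <= (b 0 i - a 0 i) / s by rewrite divr_ge0 ?subr_ge0// ltW.
have sumF i : \sum_j F i j <= b 0 i - a 0 i + s.
  rewrite /F -big_mkcond/= -(big_ord_widen M (fun=> s) (leq_bigmax i)).
  rewrite sumr_const card_ord.
  rewrite -mulr_natl /N -natr1 mulrDl mul1r lerD2r -ler_pdivlMr//.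
  by rewrite truncn_le l0.
have cover : box a b `<=` \bigcup_f cube f.
  move=> x xab.
  have y0 i : 0 <= (x 0 i - a 0 i) / s.
    by rewrite divr_ge0 ?(ltW sgt0)// subr_ge0; have /andP[] := xab i.
  have ltN (i : 'I_n.+1) : (Num.trunc ((x 0 i - a 0 i) / s)%R < N i)%N.
    rewrite /N ltnS; apply: le_truncn; rewrite ler_pM2r ?invr_gt0// lerD2r.
    by have /andP[] := xab i.
  have ltM (i : 'I_n.+1) : (Num.trunc ((x 0 i - a 0 i) / s)%R < M)%N.
    by apply: leq_trans (ltN i) _; rewrite /M leq_bigmax.
  exists [ffun i => Ordinal (ltM i)] => //; rewrite /cube ifT; last first.
    by apply/forallP => i; rewrite ffunE; exact: ltN.
  move=> i; rewrite !mxE !ffunE /=.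
  have /andP[] := truncn_itv (y0 i).
  rewrite ler_pdivlMr// ltr_pdivrMr//; set t := Num.trunc _.
  rewrite -natr1 mulrDl mul1r => h1 h2.
  by apply/andP; split; lra.
apply: le_trans (le_outer_measure phi _ _ cover) _.
apply: le_trans (outer_measure_bigcup_fin _) _.
apply: (@le_trans _ _ (\sum_(f : {ffun 'I_n.+1 -> 'I_M})
  (kappa * \prod_i F i (f i))%:E)%E).
  apply: lee_sum => f _; rewrite /cube; case: ifPn => [/forallP fN|_].
    rewrite (eq_bigr (fun=> s)); last by move=> i _; rewrite /F fN.
    by rewrite prodr_const card_ord phi_cube// sgt0.
  rewrite outer_measure0 lee_fin mulr_ge0// prodr_ge0// => i _.
  by rewrite /F; case: ifP => // _; exact: ltW.
rewrite sumEFin lee_fin -mulr_sumr ler_wpM2l// -bigA_distr_bigA/=.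
apply: ler_prod => i _; rewrite sumF andbT sumr_ge0// => j _.
by rewrite /F; case: ifP => // _; exact: ltW.
Qed.

Let phi_box (a b : 'rV[R]_n.+1) : (forall i, a 0 i <= b 0 i) ->
  (phi (box a b) <= (kappa * vol a b)%:E)%E.
Proof.
move=> ab.
have cvgp : (kappa * \prod_i (b 0 i - a 0 i + s))%:E @[s --> 0^'+] -->
    (kappa * vol a b)%:E.
  apply: cvg_EFin; first by near=> s.
  apply: cvgMr; apply: cvg_big => [x|i _].
    by apply: cvgM; [exact: cvg_fst|exact: cvg_snd].
  rewrite -[X in _ --> X]addr0; apply: cvgD; first exact: cvg_cst.
  exact/cvg_at_right_filter/cvg_id.
rewrite -(cvg_lim _ cvgp)//; apply: lime_ge; first by apply/cvg_ex; eexists;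
  exact: cvgp.
near=> s; apply: phi_box_grid => //; apply/andP; split.
  by near: s; exact: nbhs_right_gt.
by near: s; exact: nbhs_right_le.
Unshelve. all: by end_near. Qed.

(** Grids of small mesh exhaust a box up to an arbitrarily small excess volume,
    so a bound on small cubes extends to boxes, and then to covers by boxes. *)
Lemma le_lebesgue_outer_cube (E : set 'rV[R]_n.+1) :
  (phi E <= kappa%:E * lebesgue_outer E)%E.
Proof.
move: kappa_ge0; rewrite le_eqVlt => /predU1P[k0|k0].
  (* Since [0 * +oo = 0], this case means that [phi] vanishes everywhere. *)
  rewrite -k0 mul0e.
  pose a k : 'rV[R]_n.+1 := const_mx (- k%:R).
  pose b k : 'rV[R]_n.+1 := const_mx (k%:R).
  apply: (@le_trans _ _ (phi (\bigcup_k box (a k) (b k)))).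
    apply: le_outer_measure => x _.
    exists (Num.trunc `|x|).+1 => //= i; rewrite !mxE -ler_norml.
    rewrite (le_trans (coord_le_mx_norm _ _))// ltW//.
    by have /andP[] := truncn_itv (normr_ge0 x).
  apply: (le_trans (outer_measure_sigma_subadditive phi _)).
  rewrite eseries0// => k _ _; apply/eqP; rewrite eq_le outer_measure_ge0 andbT.
  have := @phi_box (a k) (b k); rewrite -k0 mul0r; apply=> i.
  by rewrite !mxE; apply: (@le_trans _ _ 0); rewrite ?oppr_le0.
rewrite -lee_pdivrMl//; apply: le_ereal_inf_tmp => _ [ab [ab_le Eab] <-].
rewrite lee_pdivrMl// -nneseriesZl; last first.
  by move=> k _; rewrite lee_fin; exact: vol_ge0.
apply: le_trans (le_outer_measure phi _ _ Eab) _.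
apply: (le_trans (outer_measure_sigma_subadditive phi _)).
apply: lee_nneseries => [k _ _|k _]; first exact: outer_measure_ge0.
by rewrite -EFinM; exact: phi_box.
Qed.

End cube_test.

Section hausdorff_content.
Context {R : realType} {n : nat}.
Implicit Types (A B E : set 'rV[R]_n) (d r : R) (s : nat).

Lemma ediam_leP A d :
  (forall x y, A x -> A y -> enorm (x - y) <= d) -> (ediam A <= d%:E)%E.
Proof.
move=> Ad; apply: ge_ereal_sup => _ [[x y] [/= Ax Ay] <-].
by rewrite lee_fin; exact: Ad.
Qed.

Lemma ediam_ge A x y : A x -> A y -> ((enorm (x - y))%:E <= ediam A)%E.
Proof. by move=> Ax Ay; apply: ereal_sup_ubound; exists (x, y). Qed.

Lemma hausdorff_gauge_le s A d : (0 <= omega R s)%R -> 0 <= d ->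
  (ediam A <= d%:E)%E ->
  (hausdorff_gauge s A <= (omega R s / 2 ^+ s * d ^+ s)%:E)%E.
Proof.
move=> w0 d0 Ad; rewrite /hausdorff_gauge.
have c0 : 0 <= omega R s / 2 ^+ s by rewrite divr_ge0// exprn_ge0.
case: ifPn => [_|/set0P[x Ax]]; first by rewrite lee_fin mulr_ge0// exprn_ge0.
have : (0%:E <= ediam A)%E.
  apply: le_trans (ediam_ge Ax Ax); rewrite lee_fin; exact: enorm_ge0.
case: (ediam A) Ad => [r| |]//; rewrite !lee_fin => rd r0.
by rewrite -EFin_expe -EFinM lee_fin ler_wpM2l// lerXn2r.
Qed.

Let T := g_sigma_algebraType [set: set 'rV[R]_n].

Let gauge s d (A : set T) : \bar R :=
  if (ediam A <= d%:E)%E then hausdorff_gauge s A else +oo%E.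

Let gauge_ge0 s d (A : set T) : (0 <= gauge s d A)%E.
Proof. by rewrite /gauge; case: ifP => // _; exact: hausdorff_gauge_ge0. Qed.

Let gauge0 s d : gauge s d set0 = 0%E.
Proof.
rewrite /gauge /hausdorff_gauge eqxx; case: ifPn => //.
by rewrite /ediam setX0 image_set0 ereal_sup0 leNye.
Qed.

(** Restricting the diameters of a cover amounts to giving infinite weight to
    the sets of larger diameter. *)
Let hausdorff_deltaE s d : @hausdorff_delta R n s d = mu_ext (gauge s d).
Proof.
apply/funext => B; apply/eqP; rewrite eq_le; apply/andP; split.
  apply: le_ereal_inf_tmp => _ [A [_ BA] <-].
  have [dA|/existsNP[k /negP dAk]] := pselect
    (forall k, (ediam (A k) <= d%:E)%E).
    apply: ereal_inf_lbound; exists A => //.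
    by apply: eq_eseriesr => k _; rewrite /gauge dA.
  rewrite (@eseries_pinfty _ _ _ k) ?leey//.
    by move=> i _; rewrite gt_eqF// (lt_le_trans _ (gauge_ge0 _ _ _))// ltNy0.
  by rewrite /gauge (negbTE dAk).
apply: le_ereal_inf_tmp => _ [A [dA BA] <-].
apply: ereal_inf_lbound; exists A.
  by split=> // k; exact: sub_sigma_algebra.
by apply: eq_eseriesr => k _; rewrite /gauge dA.
Qed.

Let hausdorff_delta0 s d : @hausdorff_delta R n s d set0 = 0%E.
Proof. by rewrite hausdorff_deltaE mu_ext0. Qed.

Lemma hausdorff_delta_ge0 s d A : (0 <= hausdorff_delta s d A)%E.
Proof. by rewrite hausdorff_deltaE mu_ext_ge0. Qed.

Let le_hausdorff_delta s d :
  {homo @hausdorff_delta R n s d : A B / A `<=` B >-> (A <= B)%E}.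
Proof. by move=> A B AB; rewrite hausdorff_deltaE; apply: le_mu_ext. Qed.

Let hausdorff_delta_sigma_subadditive s d :
  sigma_subadditive (@hausdorff_delta R n s d).
Proof.
rewrite hausdorff_deltaE => F.
exact: (mu_ext_sigma_subadditive (gauge_ge0 s d) F).
Qed.

HB.instance Definition _ s d := isOuterMeasure.Build R 'rV[R]_n
  (@hausdorff_delta R n s d) (hausdorff_delta0 s d) (@hausdorff_delta_ge0 s d)
  (@le_hausdorff_delta s d) (@hausdorff_delta_sigma_subadditive s d).

Lemma hausdorff_delta_le_gauge s d A :
  (ediam A <= d%:E)%E -> (hausdorff_delta s d A <= hausdorff_gauge s A)%E.
Proof.
move=> Ad; rewrite hausdorff_deltaE.
apply: (@le_trans _ _ (gauge s d A)); last by rewrite /gauge Ad.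
apply: ereal_inf_lbound; exists (fun k => if k == 0%N then A else set0).
  by split=> [k|x]; [exact: sub_sigma_algebra|exists 0%N].
rewrite nneseries_recl//= [X in (_ + X)%E]eseries0 ?adde0//.
by move=> [|k] // _ _; exact: gauge0.
Qed.

End hausdorff_content.

Section hausdorff_le_lebesgue.
Context {R : realType} {n : nat}.
Implicit Types (E : set 'rV[R]_n.+1) (c : 'rV[R]_n.+1) (d s kappa : R).
Local Notation w := (omega R n.+1 / 2 ^+ n.+1).
Local Notation content := (@hausdorff_delta R n.+1 n.+1).

Let w_ge0 : 0 <= w. Proof. by rewrite divr_ge0 ?omega_ge0 ?exprn_ge0. Qed.

Let cube c s := box c (c + const_mx s).

Let cube_vol c s : vol c (c + const_mx s) = s ^+ n.+1.
Proof.
rewrite -[in RHS](card_ord n.+1) -prodr_const; apply: eq_bigr => i _.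
by rewrite !mxE addrAC subrr add0r.
Qed.

Let ediam_cube c s : 0 <= s -> (ediam (cube c s) <= (n.+1%:R * s)%:E)%E.
Proof.
move=> s0; apply: ediam_leP => x y cx cy.
apply: le_trans (enorm_le_mx_norm _) _; rewrite ler_wpM2l// [leLHS]mx_normrE.
apply/bigmax_leP; split=> [//|[i j] _]; rewrite (ord1 i) !mxE/= ler_norml.
have := cx j; have := cy j; rewrite !mxE => /andP[? ?] /andP[? ?].
by apply/andP; split; lra.
Qed.

Let content_cube d c s : 0 < s <= d / n.+1%:R ->
  (content d (cube c s) <= (w * n.+1%:R ^+ n.+1 * s ^+ n.+1)%:E)%E.
Proof.
move=> /andP[s0 sd].
have nsd : n.+1%:R * s <= d by rewrite mulrC -ler_pdivlMr ?ltr0n.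
apply: (le_trans (hausdorff_delta_le_gauge _ _)).
  by apply: le_trans (ediam_cube _ (ltW s0)) _; rewrite lee_fin.
apply: le_trans (hausdorff_gauge_le omega_ge0 _ (ediam_cube _ (ltW s0))) _.
  by rewrite mulr_ge0// ltW.
by rewrite lee_fin exprMn mulrA.
Qed.

Let ball_cube c s : 0 < s -> eball (c + const_mx (s / 2)) (s / 2) `<=` cube c s.
Proof.
move=> s0 x; rewrite /eball/= => xs i.
have := le_lt_trans (coord_le_enorm _ i) xs.
by rewrite !mxE ltr_norml => /andP[? ?]; apply/andP; split; lra.
Qed.

Let w_le1 : w <= 1.
Proof.
have := le_lebesgue_outer (@ball_cube 0 1 ltr01).
rewrite lebesgue_outer_eball ?divr_ge0// => /le_trans.
move=> /(_ _ (lebesgue_outer_box _)); rewrite cube_vol lee_fin expr1n.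
by rewrite div1r exprVn; apply=> i; rewrite !mxE lerDl.
Qed.

(** The ball inscribed in a small cube has the right content, by the choice of
    the normalizing constant, and fills the fraction [w] of the cube; the rest
    of the cube is estimated by the bound with the constant [kappa]. *)
Let content_improve d kappa : 0 < d -> 0 <= kappa ->
  (forall E, (content d E <= kappa%:E * lebesgue_outer E)%E) ->
  forall E, (content d E <= (w + kappa * (1 - w))%:E * lebesgue_outer E)%E.
Proof.
move=> d0 k0 dk.
have s00 : 0 < d / n.+1%:R by rewrite divr_gt0// ltr0n.
apply: (le_lebesgue_outer_cube _ s00) => [|c s /andP[s0 sd]].
  by rewrite addr_ge0// mulr_ge0// subr_ge0.
rewrite -/(cube c s); set B := eball (c + const_mx (s / 2)) (s / 2).
have s20 : 0 <= s / 2 by rewrite divr_ge0// ltW.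
have LB : lebesgue_outer B = (w * s ^+ n.+1)%:E.
  by rewrite lebesgue_outer_eball// exprMn exprVn mulrA mulrAC.
have -> : cube c s = B `|` (cube c s `\` B).
  by apply/esym/setDUK; exact: ball_cube.
apply: (le_trans (outer_measureU2 _ _ _)).
rewrite mulrDl -[(kappa * _ * _)%R]mulrA EFinD; apply: leeD.
  have dB : (ediam B <= s%:E)%E.
    apply: ediam_leP => x y xB yB.
    apply: le_trans (enorm_distD (c + const_mx (s / 2)) _ _) _.
    rewrite [enorm (_ - y)]enormB.
    by move: xB yB; rewrite /B /eball/= => xB yB; lra.
  apply: (le_trans (hausdorff_delta_le_gauge _ _)).
    apply: (le_trans dB); rewrite lee_fin.
    rewrite (le_trans _ (_ : n.+1%:R * s <= _))//.
      by rewrite ler_peMl ?ler1n// ltW.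
    by rewrite mulrC -ler_pdivlMr// ltr0n.
  exact: (hausdorff_gauge_le omega_ge0 (ltW s0) dB).
apply: (le_trans (dk _)).
rewrite EFinM lee_wpmul2l ?lee_fin// mulrBl mul1r EFinB -LB.
have := open_caratheodory (@open_eball R n.+1 (c + const_mx (s / 2)) (s / 2))
  (cube c s).
rewrite (setIidr (@ball_cube c s s0)) -/B -setDE => cE.
have : (lebesgue_outer (cube c s) <= (s ^+ n.+1)%:E)%E.
  rewrite -(cube_vol c) lebesgue_outer_box// => i.
  by rewrite !mxE lerDl ltW.
by rewrite cE LB => h; rewrite leeBrDr // addeC.
Qed.

(** Iterating the previous improvement contracts the constant of any bound
    towards [1], unless [w] vanishes, in which case so does the content. This
    replaces a Vitali covering of the cube by balls. *)
Lemma hausdorff_delta_le_lebesgue d E : 0 < d ->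
  (content d E <= lebesgue_outer E)%E.
Proof.
move=> d0.
have s00 : 0 < d / n.+1%:R by rewrite divr_gt0// ltr0n.
pose k0 := w * n.+1%:R ^+ n.+1.
have k00 : 0 <= k0 by rewrite mulr_ge0// exprn_ge0.
have init A : (content d A <= k0%:E * lebesgue_outer A)%E.
  by apply: (le_lebesgue_outer_cube k00 s00) => c s; exact: content_cube.
have [w0|w0] := eqVneq w 0.
  have := init E; rewrite /k0 w0 mul0r mul0e => /le_trans; apply.
  exact: lebesgue_outer_ge0.
have {w0} w0 : 0 < w by rewrite lt_neqAle eq_sym w0.
pose K := Num.max k0 1.
have iter k A : (content d A <= (1 + (1 - w) ^+ k * (K - 1))%:E * lebesgue_outer
  A)%E.
  elim: k A => [|k ih] A.
    apply: (le_trans (init A)); rewrite expr0 mul1r addrC subrK.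
    by rewrite lee_wpmul2r ?lebesgue_outer_ge0// lee_fin le_max lexx.
  have := content_improve d0 _ ih => /(_ _ A)/le_trans; apply.
    by rewrite addr_ge0// mulr_ge0// ?exprn_ge0 ?subr_ge0// le_max lexx orbT.
  rewrite lee_wpmul2r ?lebesgue_outer_ge0// lee_fin [(1 - w) ^+ k.+1]exprS.
  set p := (1 - w) ^+ k; set v := omega R n.+1 / _.
  by rewrite le_eqVlt; apply/orP; left; apply/eqP; ring.
have [->|Eoo] := eqVneq (lebesgue_outer E) +oo%E; first by rewrite leey.
have EE : lebesgue_outer E = (fine (lebesgue_outer E))%:E.
  by rewrite fineK// ge0_fin_numE ?lebesgue_outer_ge0// ltey.
have cvgk : (1 + (1 - w) ^+ k * (K - 1))%:E * lebesgue_outer E @[k --> \oo]%E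
    --> lebesgue_outer E.
  rewrite EE -[X in _ --> X]mul1e; under eq_fun do rewrite -EFinM.
  rewrite -EFinM; apply: cvg_EFin; first by near=> k.
  apply: cvgMl; rewrite -[X in _ --> X]addr0; apply: cvgD; first exact: cvg_cst.
  rewrite -(mul0r (K - 1)); apply: cvgMl; apply: cvg_expr.
  by rewrite ger0_norm ?subr_ge0//; lra.
rewrite -(cvg_lim _ cvgk)//; apply: lime_ge; first by apply/cvg_ex; eexists;
  exact: cvgk.
by near=> k; exact: iter.
Unshelve. all: by end_near. Qed.

End hausdorff_le_lebesgue.

(** * Integrals over covers, measures of Lipschitz images *)

Section integral_cover_bound.
Context {R : realType} {T : pointedType}.
Variable mu : {outer_measure set T -> \bar R}.
Local Open Scope ereal_scope.
Import HBNNSimple.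

Let sum_preimage_le (h : T -> R) (rs : seq R) (Y : set T) : uniq rs ->
  (forall r, mu.-caratheodory (h @^-1` [set r])) ->
  \sum_(r <- rs) mu (Y `&` h @^-1` [set r]) <= mu Y.
Proof.
move=> + mh; elim: rs Y => [|r rs ih] Y /=.
  by rewrite big_nil outer_measure_ge0.
move=> /andP[rrs urs]; rewrite big_cons [leRHS](mh r).
apply: leeD => //; apply: le_trans (ih _ urs).
rewrite le_eqVlt; apply/orP; left; apply/eqP.
apply: eq_big_seq => r' r'rs; congr (mu _); apply/seteqP; split=> x /=.
  move=> [Yx hx]; do 2 split => //; rewrite hx => rr'.
  by move: rrs; rewrite -rr' r'rs.
by move=> [[]].
Qed.

Let sum_levels_le_cover (h : T -> R) (rs : seq R) (X : set T) (f : T -> \bar R)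
    (A : (set T)^nat) (a : (\bar R)^nat) :
  uniq rs -> {in rs, forall r, 0 <= r}%R ->
  (forall r, mu.-caratheodory (h @^-1` [set r])) ->
  (forall x, (0 < h x)%R -> X x /\ (h x)%:E <= f x) ->
  (forall k, 0 <= a k) -> X `<=` \bigcup_k A k ->
  (forall k x, X x -> A k x -> f x <= a k) ->
  \sum_(r <- rs) r%:E * mu (h @^-1` [set r]) <= \sum_(k <oo) a k * mu (A k).
Proof.
move=> urs rs0 mh hX a0 XA fa.
pose g (r : R) := \sum_(k <oo) a k * mu (A k `&` h @^-1` [set r]).
apply: (@le_trans _ _ (\sum_(r <- rs) g r)).
  rewrite !big_seq; apply: lee_sum => r /rs0.
  rewrite le_eqVlt => /predU1P[<-|r0].
    rewrite mul0e; apply: nneseries_ge0 => k _ _.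
    by rewrite mule_ge0// outer_measure_ge0.
  apply: (@le_trans _ _ (r%:E * \sum_(k <oo) mu (A k `&` h @^-1` [set r]))).
    apply: lee_wpmul2l; first by rewrite lee_fin ltW.
    apply: (le_trans _ (outer_measure_sigma_subadditive mu _)).
    apply: le_outer_measure => x /= hx.
    have [|/XA[k _ Ax] _] := hX x; first by rewrite hx.
    by exists k.
  rewrite -nneseriesZl; last by move=> k _; exact: outer_measure_ge0.
  apply: lee_nneseries => [k _ _|k _].
    by rewrite mule_ge0// ?lee_fin ?ltW// outer_measure_ge0.
  have [->|/set0P[x [Ax /= hx]]] := eqVneq (A k `&` h @^-1` [set r]) set0.
    by rewrite outer_measure0 !mule0.
  rewrite lee_wpmul2r ?outer_measure_ge0//.
  have [|Xx rf] := hX x; first by rewrite hx.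
  by rewrite -hx; exact: le_trans rf (fa _ _ Xx Ax).
rewrite /g -nneseries_sum; last first.
  by move=> r k _; rewrite mule_ge0// outer_measure_ge0.
apply: lee_nneseries => [k _ _|k _].
  by apply: sume_ge0 => r _; rewrite mule_ge0// outer_measure_ge0.
rewrite -ge0_sume_distrr; last by move=> r _; exact: outer_measure_ge0.
by rewrite lee_wpmul2l//; exact: sum_preimage_le.
Qed.

(** The integral is a supremum over simple functions, and a Caratheodory
    measurable partition splits the outer measure of an arbitrary set; so
    the pieces of the cover and the integrand may be arbitrary. *)
Lemma integral_le_cover (X : set T) (f : T -> \bar R) (A : (set T)^nat)
    (a : (\bar R)^nat) : (forall k, 0 <= a k) -> X `<=` \bigcup_k A k ->
  (forall k x, X x -> A k x -> f x <= a k) ->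
  integral (mu : set (caratheodory_type mu) -> \bar R) X f <=
    \sum_(k <oo) a k * mu (A k).
Proof.
move=> a0 XA fa; rewrite /integral.
set F := ereal_sup _; set G := ereal_sup _.
have G0 : 0 <= G.
  apply: ereal_sup_ubound; exists nnsfun0; last exact: sintegral0.
  by move=> x; rewrite funenegE le_max lexx orbT.
apply: (@le_trans _ _ F); first by rewrite -[leRHS]sube0; exact: leeB.
apply: ge_ereal_sup => _ [h /= hf <-].
rewrite sintegralE fsbig_finite//=.
apply: (@sum_levels_le_cover h _ X f) => //; first exact: finmap.fset_uniq.
- by move=> r; rewrite in_fset_set// inE => -[x _ <-]; exact: fun_ge0.
- by move=> r; exact: (measurable_funPTI h (measurable_set1 r)).
- move=> x hx; move: (hf x); rewrite /patch funeposE;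
    case: ifPn => [/set_mem Xx|_].
    by rewrite le_max => /orP[|]//; rewrite lee_fin leNgt hx.
  by rewrite maxxx lee_fin leNgt hx.
Qed.

End integral_cover_bound.

Section lipschitz_image.
Context {R : realType} {n p : nat}.

(** The image of a cover by sets of diameter at most [d0] is a cover by sets
    whose diameters are multiplied by at most [La]; hence only the behaviour of
    [f] at small scale matters. *)
Lemma hausdorff_lipschitz_image (E : set 'rV[R]_n.+1)
    (f : 'rV[R]_n.+1 -> 'rV[R]_p) (La d0 : R) : 0 < La -> 0 < d0 ->
  (forall x y, E x -> E y -> enorm (x - y) <= d0 ->
    enorm (f x - f y) <= La * enorm (x - y)) ->
  (hausdorff n.+1 (f @` E) <= (La ^+ n.+1)%:E * lebesgue_outer E)%E.
Proof.
move=> La0 d00 fL; apply: ge_ereal_sup => _ [d /= dgt0 <-].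
pose d' := Num.min d0 (d / La).
have d'0 : 0 < d' by rewrite lt_min d00 divr_gt0.
apply: (@le_trans _ _ ((La ^+ n.+1)%:E * hausdorff_delta n.+1 d' E)%E);
  last first.
  apply: lee_wpmul2l; first by rewrite lee_fin exprn_ge0// ltW.
  exact: hausdorff_delta_le_lebesgue.
rewrite -lee_pdivrMl ?exprn_gt0//.
apply: le_ereal_inf_tmp => _ [A [Ad EA] <-].
rewrite lee_pdivrMl ?exprn_gt0// -nneseriesZl; last first.
  by move=> k _; exact: hausdorff_gauge_ge0.
have diam_fA k x y : A k x -> E x -> A k y -> E y ->
    enorm (f x - f y) <= La * enorm (x - y) /\ La * enorm (x - y) <= d.
  move=> Ax Ex Ay Ey.
  have : enorm (x - y) <= d'.
    by rewrite -lee_fin; exact: le_trans (ediam_ge Ax Ay) (Ad k).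
  rewrite le_min => /andP[xy0 xyd]; split; first exact: fL.
  by rewrite mulrC -ler_pdivlMr.
apply: (@le_trans _ _ (\sum_(k <oo) hausdorff_gauge n.+1 (f @` (A k `&` E)))%E).
  apply: ereal_inf_lbound; exists (fun k => f @` (A k `&` E)) => //;
    split => [k|].
    apply: ediam_leP => _ _ [x [Ax Ex] <-] [y [Ay Ey] <-].
    by have [h1 h2] := diam_fA k x y Ax Ex Ay Ey; exact: le_trans h1 h2.
  move=> _ [x Ex <-]; have [k _ Ax] := EA _ Ex; exists k => //.
  by exists x.
apply: lee_nneseries => [k _ _|k _]; first exact: hausdorff_gauge_ge0.
have [->|/set0P[x [Ax Ex]]] := eqVneq (A k `&` E) set0.
  rewrite image_set0 {1}/hausdorff_gauge eqxx mule_ge0//.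
    by rewrite lee_fin exprn_ge0// ltW.
  exact: hausdorff_gauge_ge0.
rewrite [X in (_ * X)%E]/hausdorff_gauge ifF; last first.
  by apply/negbTE/set0P; exists x.
have : (ediam (A k) <= d'%:E)%E by exact: Ad.
have : (0%:E <= ediam (A k))%E.
  by apply: le_trans (ediam_ge Ax Ax); rewrite lee_fin enorm_ge0.
case rE : (ediam (A k)) => [r| |]//; rewrite !lee_fin => r0 rd.
have fAr : (ediam (f @` (A k `&` E)) <= (La * r)%:E)%E.
  apply: ediam_leP => _ _ [y [Ay Ey] <-] [y' [Ay' Ey'] <-].
  have [h _] := diam_fA k y y' Ay Ey Ay' Ey'.
  apply: (le_trans h); rewrite ler_pM2l// -lee_fin -rE.
  exact: ediam_ge.
apply: le_trans (hausdorff_gauge_le omega_ge0 _ fAr) _.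
  by rewrite mulr_ge0// ltW.
by rewrite -EFin_expe -!EFinM lee_fin exprMn mulrCA.
Qed.

End lipschitz_image.

Section fin_cover.
Context {R : realType} {T : pointedType}.
Variable mu : {outer_measure set T -> \bar R}.
Local Open Scope ereal_scope.

Lemma integral_le_fin_cover (X : set T) (f : T -> \bar R) (L : nat)
    (A : (set T)^nat) (a u : R^nat) :
  (forall i, (i < L)%N -> 0 <= a i)%R ->
  (forall x, X x -> exists2 i, (i < L)%N & A i x) ->
  (forall i x, (i < L)%N -> X x -> A i x -> f x <= (a i)%:E) ->
  (forall i, (i < L)%N -> mu (A i) <= (u i)%:E) ->
  integral (mu : set (caratheodory_type mu) -> \bar R) X f <=
    (\sum_(i < L) a i * u i)%:E.
Proof.
move=> a0 XA fa Au.
pose A' i := if (i < L)%N then A i else set0.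
pose a' i : \bar R := if (i < L)%N then (a i)%:E else 0.
have a'0 i : 0 <= a' i by rewrite /a'; case: ifP => // iL; rewrite lee_fin a0.
have XA' : X `<=` \bigcup_i A' i.
  by move=> x /XA[i iL Aix]; exists i => //; rewrite /A' iL.
have fa' i x : X x -> A' i x -> f x <= a' i.
  by rewrite /A' /a'; case: ifP => // iL; exact: fa.
have h := @integral_le_cover R T mu X f A' a' a'0 XA' fa'.
refine (le_trans h _).
rewrite (nneseries_split _ L); last first.
  by move=> i _; rewrite mule_ge0// outer_measure_ge0.
rewrite [X in _ + X]eseries0 ?adde0; last first.
  by move=> i; rewrite add0n leqNgt /a' => /negbTE ->; rewrite mul0e.
rewrite add0n big_mkord -sumEFin; apply: lee_sum => i _.
by rewrite /a' /A' ltn_ord EFinM lee_wpmul2l ?lee_fin ?a0// Au.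
Qed.

End fin_cover.

(** * Volumes of balls in consecutive dimensions *)

Section omega_lower_bound.
Context {R : realType} {n : nat}.
Local Notation k := n.+1.
Implicit Types (x : 'rV[R]_(k + 1)) (A : set 'rV[R]_(k + 1)).

Let vol_split (a b : 'rV[R]_(k + 1)) :
  vol a b = vol (lsubmx a) (lsubmx b) * (lastc b - lastc a).
Proof.
rewrite /vol big_split_ord/= big_ord1; congr (_ * _).
  by apply: eq_bigr => i _; rewrite !mxE.
by rewrite /lastc !mxE.
Qed.

(** Slicing a cover of [A] by boxes at the height [s] gives a cover of the
    slice of [A], whose total volume is then integrated over [s]. *)
Lemma lebesgue_outer_slab A (a b c : R) : 0 <= c -> a <= b ->
  (forall s, a < s <= b ->
    (c%:E <= lebesgue_outer [set y : 'rV[R]_k | A (row_mx y s%:M)])%E) ->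
  ((c * (b - a))%:E <= lebesgue_outer A)%E.
Proof.
move=> c0 ab cA; apply: le_ereal_inf_tmp => _ [B [B_le AB] <-].
pose v j := vol (lsubmx (B j).1) (lsubmx (B j).2).
have lB_le j i : lsubmx (B j).1 0 i <= lsubmx (B j).2 0 i by rewrite !mxE.
have lastB_le j : lastc (B j).1 <= lastc (B j).2 by rewrite /lastc !mxE.
have v0 j : 0 <= v j by exact: vol_ge0.
pose I j := `[lastc (B j).1, lastc (B j).2]%classic.
have slice s : a < s <= b -> (c%:E <= \sum_(j <oo) (v j * \1_(I j) s)%:E)%E.
  move=> /cA/le_trans; apply.
  pose F j := if s \in I j then box (lsubmx (B j).1) (lsubmx (B j).2) else set0.
  apply: (@le_trans _ _ (lebesgue_outer (\bigcup_j F j))).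
    apply: le_lebesgue_outer => y /= /AB[j _ yj]; exists j => //.
    have sI : s \in I j.
      rewrite inE /I/= in_itv/= /lastc !mxE.
      by have := yj (rshift k 0); rewrite row_mxEr mxE eqxx mulr1n.
    rewrite /F sI => i; have := yj (lshift 1 i).
    by rewrite row_mxEl !mxE.
  apply: (le_trans (outer_measure_sigma_subadditive (@lebesgue_outer R k) _)).
  apply: lee_nneseries => [j _ _|j _]; first exact: outer_measure_ge0.
  rewrite /F indicE; case: ifPn => sI.
    by rewrite mulr1; apply: lebesgue_outer_box => i; exact: lB_le.
  by rewrite mulr0 outer_measure0.
have mI j : measurable (I j) by exact: measurable_itv.
pose f j : R -> \bar R := fun s => (v j * \1_(I j) s)%:E.
have mf j : measurable_fun setT (f j).
  by apply/measurable_EFinP/measurable_funM.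
have f0 j (s : R) : (0 <= f j s)%E.
  by rewrite lee_fin mulr_ge0// indicE ler0n.
apply: (@le_trans _ _ (\int[lebesgue_measure]_(s in `]a, b]) c%:E)%E).
  rewrite integral_cst//= lebesgue_measure_itv/= lte_fin.
  case: ltP => [_|ba]; first by rewrite -EFinB EFinM.
  by rewrite mule0 lee_fin mulr_ge0_le0// subr_le0.
apply: (@le_trans _ _
    (\int[lebesgue_measure]_(s in `]a, b]) \sum_(j <oo) f j s)%E).
  apply: ge0_le_integral => //.
    by apply: ge0_emeasurable_sum => // j _; exact: measurable_funTS (mf j).
rewrite integral_nneseries//; last by move=> j; exact: measurable_funTS (mf j).
apply: lee_nneseries => [j _ _|j _]; first by apply: integral_ge0 => s _.
rewrite -/(vol _ _) vol_split -/(v j).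
have -> : (\int[lebesgue_measure]_(s in `]a, b]) f j s =
    (v j)%:E * \int[lebesgue_measure]_(s in `]a, b]) (\1_(I j) s)%:E)%E.
  have vI : v j < 0 -> I j = set0 by rewrite ltNge v0.
  exact: (@integralZl_indic _ _ R lebesgue_measure _ _ (fun=> I j) (v j) vI
    (mI j)).
rewrite integral_indic//; last exact: mI.
apply: (@le_trans _ _ ((v j)%:E * (lastc (B j).2 - lastc (B j).1)%:E)%E);
  last first.
  by rewrite -EFinM.
apply: lee_wpmul2l; first by rewrite lee_fin.
apply: (@le_trans _ _ (lebesgue_measure (I j))).
  apply: le_measure; rewrite ?inE//; last exact: mI.
  exact: (measurableI _ _ (mI j) (measurable_itv _)).
rewrite lebesgue_measure_itv/= lte_fin; case: ifP => _; first by rewrite -EFinB.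
by rewrite lee_fin subr_ge0.
Qed.

End omega_lower_bound.

Section edot_row_mx.
Context {R : realType} {m : nat}.
Implicit Types (y : 'rV[R]_m) (t : R).

Lemma edot_row_mx y y' t t' :
  edot (row_mx y t%:M) (row_mx y' t'%:M) = edot y y' + t * t'.
Proof.
rewrite /edot big_split_ord/= big_ord1; congr (_ + _).
  by apply: eq_bigr => i _; rewrite !row_mxEl.
by rewrite !row_mxEr !mxE eqxx !mulr1n.
Qed.

Lemma lastc_row_mx y t : lastc (row_mx y t%:M) = t.
Proof. by rewrite /lastc row_mxKr mxE eqxx mulr1n. Qed.

Lemma row_mx_lastc (x : 'rV[R]_(m + 1)) : x = row_mx (lsubmx x) (lastc x)%:M.
Proof.
rewrite -{1}(hsubmxK x); congr row_mx; apply/rowP => i.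
by rewrite (ord1 i) /lastc [in RHS]mxE eqxx mulr1n.
Qed.

End edot_row_mx.

Section omega_recursion.
Context {R : realType} {n : nat}.
Local Notation k := n.+1.
Variable s : nat -> R.
Hypotheses (s_ge0 : forall i, 0 <= s i) (s_le1 : forall i, s i <= 1).
Hypothesis s_noninc : forall i, s i.+1 <= s i.

Let mu : {outer_measure set 'rV[R]_(k + 1) -> \bar R} :=
  @lebesgue_outer R (n + 1).+1.
Let B : set 'rV[R]_(k + 1) := eball 0 1.
Let r i := Num.sqrt (1 - s i ^+ 2).
Let c i := omega R k * r i ^+ k.

Let c_ge0 i : 0 <= c i.
Proof. by rewrite mulr_ge0 ?omega_ge0// exprn_ge0// sqrtr_ge0. Qed.

Let slice i u : `|u| <= s i ->
  ((c i)%:E <= lebesgue_outer [set y : 'rV[R]_k | B (row_mx y u%:M)])%E.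
Proof.
move=> us; rewrite /c -(lebesgue_outer_eball (0 : 'rV[R]_k)) ?sqrtr_ge0//.
apply: le_lebesgue_outer => y; rewrite /B /eball/= !subr0 => yr.
rewrite -(ltr_pXn2r (n := 2)) ?nnegrE ?enorm_ge0// enorm_sqr edot_row_mx.
have : enorm y ^+ 2 < r i ^+ 2 by rewrite ltr_pXn2r ?nnegrE ?enorm_ge0
  ?sqrtr_ge0.
rewrite enorm_sqr sqr_sqrtr ?subr_ge0 ?expr_le1// => {}yr.
have : `|u| ^+ 2 <= s i ^+ 2 by rewrite lerXn2r ?nnegrE.
by rewrite real_normK ?num_real// expr1n -expr2; lra.
Qed.

Let cut A (t : R) : mu A =
  (mu (A `&` [set x | (lastc x <= t)%R]) + mu
    (A `&` [set x | (t < lastc x)%R]))%E.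
Proof.
have mH : mu.-caratheodory [set x : 'rV[R]_(k + 1) | (lastc x <= t)%R].
  rewrite (_ : [set x | lastc x <= t] = [set x | x 0 (rshift k 0) <= t]).
    exact: (@halfspace_caratheodory R (n + 1)).
  by apply/seteqP; split=> x; rewrite /= /lastc !mxE.
rewrite [LHS]mH; congr (_ + mu (A `&` _))%E.
by apply/seteqP; split=> x /=; rewrite ltNge => /negP.
Qed.

Let upper K : ((\sum_(i < K) c i * (s i - s i.+1))%:E <=
  mu (B `&` [set x | (s K < lastc x)%R]))%E.
Proof.
elim: K => [|K ih]; first by rewrite big_ord0 outer_measure_ge0.
rewrite big_ord_recr/= addrC EFinD (cut _ (s K)); apply: leeD.
  apply: lebesgue_outer_slab => // u /andP[ltu ule].
  apply: le_trans (@slice K u _) _;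
    first by rewrite ger0_norm// ltW// (le_lt_trans _ ltu).
  by apply: le_lebesgue_outer => y /= By; rewrite lastc_row_mx.
apply: le_trans ih _; apply: le_outer_measure => x /= [Bx sx]; split=> //.
by split=> //; exact: le_lt_trans sx.
Qed.

Let lower K : ((\sum_(i < K) c i * (s i - s i.+1))%:E <=
  mu (B `&` [set x | (lastc x <= - s K)%R]))%E.
Proof.
elim: K => [|K ih]; first by rewrite big_ord0 outer_measure_ge0.
rewrite big_ord_recr/= EFinD (cut _ (- s K)); apply: leeD.
  apply: le_trans ih _; apply: le_outer_measure => x /= [Bx sx]; split=> //.
  by split=> //; rewrite (le_trans sx)// lerN2.
have -> : s K - s K.+1 = - s K.+1 - - s K by ring.
apply: lebesgue_outer_slab => [//||u /andP[ltu ule]]; first by rewrite lerN2.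
apply: le_trans (@slice K u _) _.
  have := s_ge0 K; have := s_ge0 K.+1.
  by move=> ? ?; rewrite ler_norml; apply/andP; split; lra.
by apply: le_lebesgue_outer => y /= By; rewrite lastc_row_mx.
Qed.

(** The ball contains the disjoint coaxial cylinders of radius
    [sqrt (1 - s i ^+ 2)] whose heights range over [s i.+1, s i], together with
    their mirror images. *)
Lemma omega_ge_sum K :
  2 * (omega R k * \sum_(i < K) Num.sqrt (1 - s i ^+ 2) ^+ k * (s i - s i.+1))
    <=
  omega R (k + 1).
Proof.
rewrite mulr_sumr (eq_bigr (fun i : 'I_K => c i * (s i - s i.+1))); last first.
  by move=> i _; rewrite mulrA.
rewrite -lee_fin /omega fineK; last exact: (@lebesgue_outer_eball_unit_fin R
  (n + 1)).
rewrite -/(mu B) mulr2n mulrDl !mul1r EFinD (cut B 0).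
apply: leeD.
  apply: le_trans (lower K) _; apply: le_outer_measure => x /= [Bx sx].
  by split=> //; rewrite (le_trans sx)// oppr_le0.
apply: le_trans (upper K) _; apply: le_outer_measure => x /= [Bx sx].
by split=> //; exact: le_lt_trans sx.
Qed.

End omega_recursion.

(** * A Riemann sum over annuli with geometric radii *)

Section abel_summation.
Context {R : realType}.

Lemma abel_sum (a b : nat -> R) (K : nat) : b 0%N = 0 ->
  \sum_(i < K) a i * (b i.+1 - b i) =
  a K * b K + \sum_(i < K) (a i - a i.+1) * b i.+1.
Proof.
move=> b0; elim: K => [|K ih]; first by rewrite !big_ord0 b0 mulr0 addr0.
by rewrite !big_ord_recr/= ih; ring.
Qed.

End abel_summation.

Section geometric_radii.
Context {R : realType}.
Variables (q : R) (k : nat).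
Hypotheses (q_gt0 : 0 < q) (q_lt1 : q < 1) (k_gt0 : (0 < k)%N).

(** The radius [x] such that [1 + x ^+ 2 = (q ^+ i)^-1 ^+ 2]; the annuli between
    consecutive radii are those on which [(1 + |h| ^+ 2) ^ (- 1 / 2)] lies
      between
    [q ^+ i.+1] and [q ^+ i]. *)
Definition geom_radius (i : nat) : R := Num.sqrt (1 - (q ^+ i) ^+ 2) / q ^+ i.

Lemma geom_radius0 : geom_radius 0 = 0.
Proof. by rewrite /geom_radius expr0 expr1n subrr sqrtr0 mul0r. Qed.

Lemma qX_gt0 i : 0 < q ^+ i. Proof. exact: exprn_gt0. Qed.

Lemma qX_le1 i : q ^+ i <= 1. Proof. by rewrite exprn_ile1// ltW. Qed.

Lemma geom_radius_ge0 i : 0 <= geom_radius i.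
Proof. by rewrite divr_ge0 ?sqrtr_ge0// ltW// qX_gt0. Qed.

Lemma geom_radius_sqr i : 1 + geom_radius i ^+ 2 = (q ^+ i)^-1 ^+ 2.
Proof.
have := qX_gt0 i; rewrite /geom_radius exprMn sqr_sqrtr; last first.
  by rewrite subr_ge0 expr_le1// ?qX_le1// ltW// qX_gt0.
by move=> /lt0r_neq0; move: (q ^+ i) => s s0; field.
Qed.

Lemma geom_radius_le i : geom_radius i <= geom_radius i.+1.
Proof.
rewrite -(ler_pXn2r (n := 2)) ?nnegrE ?geom_radius_ge0//
  -(lerD2l 1) !geom_radius_sqr.
have qX_ge0 j := ltW (qX_gt0 j).
rewrite lerXn2r ?nnegrE ?invr_ge0// lef_pV2 ?posrE ?qX_gt0//.
by rewrite exprS ger_pMl ?qX_gt0// ltW.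
Qed.

Lemma geom_radius_le_inv i : geom_radius i <= (q ^+ i)^-1.
Proof.
rewrite -(ler_pXn2r (n := 2)) ?nnegrE ?geom_radius_ge0 ?invr_ge0
  ?(ltW (qX_gt0 i))//.
by rewrite -geom_radius_sqr lerDr.
Qed.

(** The sum is a Riemann sum of the integral of [(1 + x ^+ 2) ^- (k + 1) / 2]
    against [d (x ^+ k)].  Summation by parts turns it into one for
    [sqrt (1 - s ^+ 2) ^+ k], in the variable [s] with
    [1 + x ^+ 2 = s ^- 2]. *)
Lemma sum_geom_radius_le (K : nat) :
  \sum_(i < K) (q ^+ i) ^+ k.+1 * (geom_radius i.+1 ^+ k - geom_radius i ^+ k)
    <=
  q ^+ K + k.+1%:R / q ^+ k.+1 *
    \sum_(i < K.+1) Num.sqrt (1 - (q ^+ i) ^+ 2) ^+ k * (q ^+ i - q ^+ i.+1).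
Proof.
rewrite (@abel_sum _ (fun i => (q ^+ i) ^+ k.+1) (fun i => geom_radius i ^+ k));
  last first.
  by rewrite geom_radius0 expr0n gtn_eqF.
have sqrt_le1 i : Num.sqrt (1 - (q ^+ i) ^+ 2) ^+ k <= 1.
  rewrite exprn_ile1 ?sqrtr_ge0// -[leRHS]sqrtr1 ler_wsqrtr// gerBl.
  by rewrite sqr_ge0.
apply: lerD.
  rewrite /geom_radius expr_div_n exprS -mulrA (mulrC _ (_ / _)) divfK
    ?expf_neq0 ?gt_eqF//.
  by rewrite ler_piMr// ltW// qX_gt0.
rewrite [in leRHS]big_ord_recl/= mulrDr -[leLHS]add0r; apply: lerD.
  apply: mulr_ge0; first by rewrite divr_ge0// exprn_ge0// ltW.
  by rewrite mulr_ge0 ?exprn_ge0 ?sqrtr_ge0// expr0 expr1 subr_ge0 ltW.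
rewrite mulr_sumr; apply: ler_sum => i _; rewrite /bump/= add1n.
have qi0 := qX_gt0 i.+1.
have -> : (q ^+ i) ^+ k.+1 = (q ^+ i.+1) ^+ k.+1 / q ^+ k.+1.
  by rewrite -!exprM mulSn exprD mulrAC divff ?mul1r// expf_neq0 ?gt_eqF.
have -> : q ^+ i.+1 - q ^+ i.+2 = q ^+ i.+1 * (1 - q).
  by rewrite [q ^+ i.+2]exprS; ring.
rewrite /geom_radius; move: (q ^+ i.+1) qi0 => s s0.
set w := Num.sqrt _ ^+ k.
have w0 : 0 <= w by rewrite exprn_ge0 ?sqrtr_ge0.
have -> : (s ^+ k.+1 / q ^+ k.+1 - s ^+ k.+1) * (Num.sqrt (1 - s ^+ 2) / s) ^+ k
  =
    s * w * ((1 - q ^+ k.+1) / q ^+ k.+1).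
  rewrite expr_div_n -/w exprS.
  by field; rewrite !expf_neq0 ?gt_eqF//.
have -> : k.+1%:R / q ^+ k.+1 * (w * (s * (1 - q))) =
    s * w * (k.+1%:R * (1 - q) / q ^+ k.+1) by ring.
rewrite ler_wpM2l ?mulr_ge0 ?(ltW s0)// ler_pM2r ?invr_gt0 ?exprn_gt0//.
rewrite -[X in X - _](expr1n _ k.+1) subrXX mulrC ler_wpM2r ?subr_ge0
  ?(ltW q_lt1)//.
rewrite -[leRHS]mulr1 -[k.+1 in leRHS]card_ord -sumr_const mulr_suml.
by apply: ler_sum => j _; rewrite mul1r expr1n mul1r qX_le1.
Qed.

Lemma sum_qX_tail_le (K L : nat) : \sum_(K <= i < L) q ^+ i <= q ^+ K / (1 - q).
Proof.
have [LK|KL] := leqP L K.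
  by rewrite big_geq// divr_ge0 ?exprn_ge0 ?subr_ge0 ?ltW.
rewrite ler_pdivlMr ?subr_gt0// mulr_suml.
rewrite (eq_bigr (fun i => - (q ^+ i.+1) - - (q ^+ i))); last first.
  by move=> i _; rewrite exprS; ring.
rewrite telescope_sumr 1?ltnW// opprK addrC gerDl oppr_le0.
by rewrite exprn_ge0// ltW.
Qed.

Lemma sum_qXV_le (L : nat) : \sum_(i < L.+1) (q ^+ i)^-1 <=
  (q ^+ L)^-1 / (1 - q).
Proof.
rewrite ler_pdivlMr ?subr_gt0//; elim: L => [|L ih].
  by rewrite big_ord1 expr0 invr1 mul1r gerBl ltW.
rewrite big_ord_recr/= mulrDl.
apply: le_trans (lerD ih (lexx _)) _.
have := qX_gt0 L; rewrite exprS; move: (q ^+ L) => s s0.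
rewrite le_eqVlt; apply/orP; left; apply/eqP; field.
by rewrite !gt_eqF.
Qed.

End geometric_radii.

(** * Tangent planes of graphs *)

Section graphs.
Context {R : realType} {m : nat}.
Implicit Types (p h y : 'rV[R]_m) (psi : 'rV[R]_m -> R) (e t : R).

Lemma gradient_approx psi y e : differentiable psi y -> 0 < e ->
  exists2 d, 0 < d & forall h, enorm h < d ->
    `|psi (y + h) - psi y - edot (gradient psi y) h| <= e * enorm h.
Proof.
move=> dpsi e0.
have dE h : 'd psi y h = edot (gradient psi y) h.
  rewrite {1}(row_sum_delta h) linear_sum; apply: eq_bigr => i _.
  by rewrite linearZ /= mxE deriveE// mulrC.
have /eqaddoP/(_ e e0)/nbhs_eball[d d0 dP] := diff_locally dpsi.
exists d => // h hd; have := dP h; rewrite /eball/= subr0 => /(_ hd).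
rewrite [X in X - _]/= fctE/= [y + h]addrC -dE opprD addrA.
by move=> /le_trans; apply; rewrite ler_wpM2l ?(ltW e0)// mx_norm_le_enorm.
Qed.

Definition graph_pt psi y : 'rV[R]_(m + 1) := row_mx y (psi y)%:M.

Definition tangent p h : 'rV[R]_(m + 1) := row_mx h (edot p h)%:M.

Lemma row_mx_scalarB y y' t t' :
  row_mx y t%:M - row_mx y' t'%:M = row_mx (y - y') (t - t')%:M :>
    'rV[R]_(m + 1).
Proof. by rewrite opp_row_mx add_row_mx raddfB. Qed.

Lemma tangentZ p t h : tangent p (t *: h) = t *: tangent p h.
Proof. by rewrite /tangent scale_row_mx edotZr scale_scalar_mx. Qed.

Lemma enorm_vertical t : enorm (row_mx 0 t%:M : 'rV[R]_(m + 1)) = `|t|.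
Proof. by rewrite /enorm edot_row_mx edot0l add0r -expr2 sqrtr_sqr. Qed.

Lemma enorm_le_row_mx y t : enorm y <= enorm (row_mx y t%:M : 'rV[R]_(m + 1)).
Proof. by rewrite /enorm edot_row_mx ler_wsqrtr// lerDl -expr2 sqr_ge0. Qed.

Lemma enorm_row_mx_le y t :
  enorm (row_mx y t%:M : 'rV[R]_(m + 1)) <= enorm y + `|t|.
Proof.
rewrite -(ler_pXn2r (n := 2)) ?nnegrE ?addr_ge0 ?enorm_ge0//.
rewrite enorm_sqr edot_row_mx sqrrD enorm_sqr -expr2 real_normK ?num_real//.
by rewrite lerD2r lerDl mulrn_wge0// mulr_ge0// enorm_ge0.
Qed.

Lemma enorm_tangent_le p h : enorm (tangent p h) <= Num.sqrt (1 + edot p p)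
  * enorm h.
Proof.
rewrite -(ler_pXn2r (n := 2)) ?nnegrE ?mulr_ge0 ?enorm_ge0 ?sqrtr_ge0//.
rewrite exprMn !enorm_sqr edot_row_mx sqr_sqrtr ?addr_ge0 ?edot_ge0//
  mulrDl mul1r.
rewrite lerD2l -expr2 -(enorm_sqr p) -(enorm_sqr h) -exprMn -real_normK
  ?num_real//.
by rewrite lerXn2r ?nnegrE ?mulr_ge0 ?enorm_ge0// edot_le.
Qed.

(** The remainder of the first order expansion of a graph is vertical. *)
Lemma graph_tangent_dist psi p y y' e :
  `|psi y' - psi y - edot p (y' - y)| <= e ->
  enorm ((graph_pt psi y' - graph_pt psi y) - tangent p (y' - y)) <= e.
Proof.
by rewrite /graph_pt /tangent !row_mx_scalarB subrr enorm_vertical.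
Qed.

Lemma lipschitz_graph psi (B : set 'rV[R]_m) : [lipschitz psi y | y in B] ->
  exists2 C, 0 < C & forall y y', B y -> B y' ->
    `|psi y - psi y'| <= C * enorm (y - y') /\
    enorm (graph_pt psi y - graph_pt psi y') <= C * enorm (y - y').
Proof.
move=> [M [_ ML]]; pose c := Num.max (M + 1) 1.
have c1 : 1 <= c by rewrite le_max lexx orbT.
have cL y y' : B y -> B y' -> `|psi y - psi y'| <= c * enorm (y - y').
  move=> By By'; have /ML/(_ (y, y')) : M < c by rewrite lt_max ltrDl ltr01.
  move=> /(_ (conj By By'))/le_trans; apply.
  by rewrite ler_wpM2l ?(le_trans ler01)// mx_norm_le_enorm.
exists (1 + c); first by rewrite addr_gt0// (lt_le_trans ltr01).
move=> y y' By By'; have h := cL _ _ By By'; split.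
  by rewrite (le_trans h)// ler_wpM2r ?enorm_ge0// lerDr.
rewrite /graph_pt row_mx_scalarB (le_trans (enorm_row_mx_le _ _))//.
by rewrite mulrDl mul1r lerD2l.
Qed.

(** [(I + c p^T p)^2 = I + p^T p] when [2 c + c^2 |p|^2 = 1], so that
    [h + c (p.h) p] has the same norm as [(h, p.h)]. *)
Lemma tangent_isometry p : exists A B : 'rV[R]_m -> 'rV[R]_m,
  [/\ cancel A B, forall x y, B x - B y = B (x - y),
      forall t x, B (t *: x) = t *: B x,
      forall x, enorm (tangent p (B x)) = enorm x &
      forall h, enorm (A h) = enorm (tangent p h)].
Proof.
pose s := Num.sqrt (1 + edot p p).
have s2 : s ^+ 2 = 1 + edot p p by rewrite sqr_sqrtr// addr_ge0 ?edot_ge0.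
have s1 : 1 <= s by rewrite -[leLHS]sqrtr1 ler_wsqrtr// lerDl edot_ge0.
have ppE : edot p p = s ^+ 2 - 1 by rewrite s2 addrC addKr.
have s0 : s != 0 by rewrite gt_eqF// (lt_le_trans ltr01).
have s10 : 1 + s != 0 by rewrite gt_eqF// addr_gt0// (lt_le_trans ltr01).
pose A h := h + (1 + s)^-1 * edot p h *: p.
pose B x := x - (s * (1 + s))^-1 * edot p x *: p.
have AB : cancel B A.
  move=> x; rewrite /A /B edotBr edotZr ppE -addrA -scaleNr -scalerDl.
  rewrite [X in x + X *: _](_ : _ = 0) ?scale0r ?addr0//.
  by field; rewrite s0 s10.
have BA : cancel A B.
  move=> x; rewrite /A /B edotDr edotZr ppE -addrA -scaleNr -scalerDl.
  rewrite [X in x + X *: _](_ : _ = 0) ?scale0r ?addr0//.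
  by field; rewrite s0 s10.
have nA h : enorm (A h) = enorm (tangent p h).
  rewrite /enorm /tangent edot_row_mx; congr Num.sqrt.
  rewrite /A !(edotDl, edotDr, edotZl, edotZr) ppE (edotC h p).
  by field.
exists A, B; split=> // [x y|t x|x].
- by apply/rowP => i; rewrite !mxE edotBr; ring.
- by rewrite /B edotZr scalerBr scalerA mulrCA.
- by rewrite -nA AB.
Qed.

End graphs.

(** * The normal at a touching point *)

Section touching_point.
Context {R : realType} {n : nat}.
Implicit Types (A Omega : set 'rV[R]_n) (x z : 'rV[R]_n).

Lemma touching_set_le A x z : touching_set A x z ->
  forall w, A w -> enorm (z - x) <= enorm (w - x).
Proof.
move=> [Az xz] w Aw; rewrite enormB xz enormB.
apply: ge_inf; last by exists w.
by exists 0 => _ [v _ <-]; exact: enorm_ge0.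
Qed.

Lemma closure_boundary Omega x : closure Omega x -> Omega x \/ boundary Omega x.
Proof.
move=> cx; have [ix|nix] := pselect (interior Omega x); last by right.
by left; exact: interior_subset.
Qed.

(** A connected segment that meets [Omega] but not its boundary stays in
    [Omega]. *)
Lemma segment_touching Omega x z (l : R) : open Omega -> Omega x ->
  (forall w, boundary Omega w -> enorm (z - x) <= enorm (w - x)) ->
  x != z -> 0 <= l < 1 -> Omega (x + l *: (z - x)).
Proof.
move=> oO Ox zx xz l01.
have r0 : 0 < enorm (z - x).
  rewrite lt_neqAle enorm_ge0 andbT eq_sym;
    apply: contra xz => /eqP/enorm_eq0/eqP.
  by rewrite subr_eq0 eq_sym.
pose g (l : R) : 'rV[R]_n := x + l *: (z - x).
have gc : continuous g.
  move=> u; apply: (@cvgD _ _ _ (nbhs u)); first exact: cvg_cst.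
  by apply: (@cvgZr_tmp _ _ _ (nbhs u)); exact: cvg_id.
have inO u : `[0, 1[%classic u -> closure Omega (g u) -> Omega (g u).
  rewrite /= in_itv/= => /andP[u0 u1] /closure_boundary[//|/zx].
  rewrite /g [x + _]addrC addrK enormZ ger0_norm// => h.
  by move: h; rewrite leNgt gtr_pMl// u1.
pose D := `[0, 1[%classic `&` g @^-1` Omega.
have cI : connected `[(0 : R), 1[%classic by apply/connected_intervalP;
  exact: interval_is_interval.
suff DI : D = `[0, 1[%classic.
  by have : `[0, 1[%classic l; [rewrite /= in_itv|rewrite -DI => -[]].
apply: cI.
- by exists 0; split; [rewrite /= in_itv/= lexx ltr01|rewrite /g /= scale0r
    addr0].
- by exists (g @^-1` Omega) => //; apply: open_comp => // u _; exact: gc.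
- exists (g @^-1` closure Omega).
    by apply: closed_comp => [u _|]; [exact: gc|exact: closed_closure].
  apply/seteqP; split=> u [Iu Ou]; split=> //; first exact: subset_closure.
  exact: inO.
Qed.

End touching_point.

Section normal_direction.
Context {R : realType} {m : nat}.
Variables (psi : 'rV[R]_m -> R) (y0 : 'rV[R]_m) (rho : R).
Hypotheses (rho_gt0 : 0 < rho) (dpsi : differentiable psi y0).
Let p := gradient psi y0.

(** The direction pointing upwards that is orthogonal to the tangent space. *)
Definition upward p : 'rV[R]_(m + 1) := row_mx (- p) 1%:M.

Lemma edot_upward h t : edot (row_mx h t%:M) (upward p) = t - edot p h.
Proof. by rewrite /upward edot_row_mx edotNr mulr1 addrC edotC. Qed.

(** The first variation of the distance to [c] along the graph vanishes, since
    the distance is minimal at [y0]. *)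
Lemma normal_orthogonal (c : 'rV[R]_(m + 1)) :
  (forall y, eball y0 rho y ->
     enorm (graph_pt psi y0 - c) <= enorm (graph_pt psi y - c)) ->
  forall h, edot (tangent p h) (graph_pt psi y0 - c) = 0.
Proof.
move=> cmin; set v := graph_pt psi y0 - c.
suff ge0 h : 0 <= edot (tangent p h) v.
  move=> h; apply/eqP; rewrite eq_le ge0 andbT.
  have := ge0 (- h); rewrite -scaleN1r tangentZ edotZl mulN1r; lra.
rewrite leNgt; apply/negP => uv0.
set u := tangent p h in uv0; set th := - edot u v.
have th0 : 0 < th by rewrite oppr_gt0.
have [H0 V0] := (enorm_ge0 h, enorm_ge0 v).
(* The quadratic inequality divided by [l] reads
   [0 <= - 2 th + 2 e |h| |v| + l W ^+ 2]; the choice of [e], and then that of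
   [l], make each of the last two terms at most [th], the latter strictly. *)
pose e := th / (2 * (enorm h * enorm v + 1)).
have hv0 : 0 <= enorm h * enorm v by rewrite mulr_ge0.
have e0 : 0 < e by rewrite divr_gt0// mulr_gt0// ltr_wpDl.
have ehv : 2 * (e * (enorm h * enorm v)) <= th.
  rewrite /e; set X := enorm h * enorm v in hv0 *.
  have -> : 2 * (th / (2 * (X + 1)) * X) = th * (X / (X + 1)).
    by field; rewrite gt_eqF// ltr_wpDl.
  by rewrite ger_pMr// ler_pdivrMr ?ltr_wpDl// mul1r lerDl.
have [d d0 dP] := gradient_approx dpsi e0.
pose W := enorm u + e * enorm h.
have W0 : 0 <= W by rewrite addr_ge0 ?enorm_ge0// mulr_ge0// ltW.
pose l := Num.min (Num.min d rho / (2 * (enorm h + 1)))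
  (th / (2 * (W ^+ 2 + 1))).
have W21 : 0 < W ^+ 2 + 1 by rewrite ltr_wpDl// sqr_ge0.
have h1 : 0 < enorm h + 1 by rewrite ltr_wpDl.
have l0 : 0 < l.
  by rewrite lt_min !divr_gt0 ?mulr_gt0// lt_min d0.
have lh : l * enorm h < Num.min d rho.
  have dr0 : 0 < Num.min d rho by rewrite lt_min d0.
  have : l * enorm h <= Num.min d rho / (2 * (enorm h + 1)) * (enorm h + 1).
    by apply: ler_pM => //; rewrite ?(ltW l0) ?ge_min ?lexx// lerDl.
  move=> /le_lt_trans; apply.
  have -> : Num.min d rho / (2 * (enorm h + 1)) * (enorm h + 1) = Num.min d
    rho / 2.
    by field; rewrite gt_eqF.
  by rewrite ltr_pdivrMr// ltr_pMr// ltr1n.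
have lW : l * W ^+ 2 < th.
  have : l * W ^+ 2 <= th / (2 * (W ^+ 2 + 1)) * (W ^+ 2 + 1).
    by apply: ler_pM; rewrite ?(ltW l0) ?sqr_ge0 ?ge_min ?lexx ?orbT// lerDl.
  move=> /le_lt_trans; apply.
  have -> : th / (2 * (W ^+ 2 + 1)) * (W ^+ 2 + 1) = th / 2.
    by field; rewrite gt_eqF.
  by rewrite ltr_pdivrMr// ltr_pMr// ltr1n.
move: lh; rewrite lt_min => /andP[lhd lhr].
have nlh : enorm (l *: h) = l * enorm h by rewrite enormZ gtr0_norm.
have : eball y0 rho (y0 + l *: h) by rewrite /eball/= addrAC subrr add0r nlh.
move=> /cmin; rewrite -/v.
set w := graph_pt psi (y0 + l *: h) - graph_pt psi y0.
have wle : enorm (w - l *: u) <= e * (l * enorm h).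
  have lhE : (y0 + l *: h) - y0 = l *: h by rewrite addrAC subrr add0r.
  rewrite /u -tangentZ -[X in tangent p X]lhE.
  by apply: graph_tangent_dist; rewrite lhE -nlh; apply: dP; rewrite nlh.
have -> : graph_pt psi (y0 + l *: h) - c = w + v by rewrite /w /v addrA subrK.
rewrite -(ler_pXn2r (n := 2)) ?nnegrE ?enorm_ge0// !enorm_sqr.
rewrite (edotDl w v) (edotDr w w v) (edotDr v w v) (edotC v w) => wv.
have wu : edot w v <= l * edot u v + e * (l * enorm h) * enorm v.
  rewrite -[X in edot X v](subrK (l *: u)) edotDl edotZl addrC lerD2l.
  apply: le_trans (ler_norm _) _; apply: le_trans (edot_le _ _) _.
  by rewrite ler_wpM2r.
have ww : edot w w <= (l * W) ^+ 2.
  rewrite -enorm_sqr lerXn2r ?nnegrE ?enorm_ge0 ?mulr_ge0 ?(ltW l0)//.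
  rewrite -[X in enorm X](subrK (l *: u)) (le_trans (enormD _ _))//
    enormZ gtr0_norm//.
  by rewrite /W mulrDr addrC lerD2l mulrCA.
have : 0 <= l * (2 * edot u v + 2 * (e * (enorm h * enorm v)) + l * W ^+ 2).
  apply: (le_trans (_ : 0 <= 2 * edot w v + edot w w)); first lra.
  have -> : l * (2 * edot u v + 2 * (e * (enorm h * enorm v)) + l * W ^+ 2) =
    2 * (l * edot u v + e * (l * enorm h) * enorm v) + (l * W) ^+ 2 by ring.
  by rewrite lerD// ler_pM2l.
rewrite pmulr_rge0//; rewrite /th in ehv lW; lra.
Qed.

End normal_direction.

Section outside_points.
Context {R : realType} {m : nat}.
Variables (Omega : set 'rV[R]_(m + 1)) (z : 'rV[R]_(m + 1)).
Variables (psi : 'rV[R]_m -> R) (rho a b : R).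
Let y0 := lsubmx z.
Let p := gradient psi y0.
Hypotheses (rho_gt0 : 0 < rho) (zab : a < lastc z < b).
Hypothesis dpsi : differentiable psi y0.
Hypothesis boundary_graph : boundary Omega `&` cylinder y0 rho a b =
  [set row_mx y (psi y)%:M | y in eball y0 rho].
Hypothesis below_graph : Omega `&` cylinder y0 rho a b =
  [set x | exists y t, [/\ x = row_mx y t%:M, eball y0 rho y, a < t < psi y
                         & psi y < b]].
Hypothesis z_boundary : boundary Omega z.

Let eball_center : eball y0 rho y0.
Proof. by rewrite /eball/= subrr enorm0. Qed.

Lemma graph_pt_center : graph_pt psi y0 = z.
Proof.
have : (boundary Omega `&` cylinder y0 rho a b) z by [].
by rewrite boundary_graph => -[y _ yz]; rewrite /graph_pt /y0 -yz row_mxKl.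
Qed.

Lemma above_graph_outside x : cylinder y0 rho a b x ->
  psi (lsubmx x) < lastc x -> ~ closure Omega x.
Proof.
move=> cx px /closure_boundary[Ox|bx].
  have : (Omega `&` cylinder y0 rho a b) x by [].
  rewrite below_graph => -[y [t [xE _ /andP[_ ty] _]]].
  by move: px; rewrite xE row_mxKl lastc_row_mx ltNge (ltW ty).
have : (boundary Omega `&` cylinder y0 rho a b) x by [].
rewrite boundary_graph => -[y _ xE].
by move: px; rewrite -xE row_mxKl lastc_row_mx ltxx.
Qed.

(** The point moves up by [tau] while the graph under it moves by
    [- tau |p| ^+ 2 + o(tau)]. *)
Lemma upward_outside : exists2 tau0, 0 < tau0 & forall tau, 0 < tau < tau0 ->
  ~ closure Omega (z + tau *: upward p).
Proof.
have p0 := enorm_ge0 p.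
have p10 : 0 < 1 + enorm p by rewrite ltr_pwDl.
have e0 : 0 < (1 + enorm p)^-1 by rewrite invr_gt0.
have [d d0 dP] := gradient_approx dpsi e0.
have /andP[za zb] := zab.
pose D := Num.min (Num.min d rho) (b - lastc z).
have D0 : 0 < D by rewrite !lt_min d0 rho_gt0 subr_gt0.
exists (D / (1 + enorm p)); first by rewrite divr_gt0.
move=> tau /andP[tau0]; rewrite ltr_pdivlMr// mulrDr mulr1 !lt_min.
move=> /andP[/andP[taud taurho] taub].
have tp0 : 0 <= tau * enorm p by rewrite mulr_ge0// ltW.
have ntp : enorm (- (tau *: p)) = tau * enorm p by rewrite enormN enormZ
  gtr0_norm.
have xE : z + tau *: upward p = row_mx (y0 - tau *: p) (lastc z + tau)%:M.
  rewrite {1}(row_mx_lastc z) /upward scale_row_mx scale_scalar_mx mulr1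
    scalerN.
  by rewrite add_row_mx raddfD.
rewrite xE; apply: above_graph_outside.
  rewrite /cylinder/= row_mxKl lastc_row_mx; split; last by apply/andP; split;
    lra.
  by rewrite /eball/= addrAC subrr add0r ntp; lra.
rewrite row_mxKl lastc_row_mx.
have psiz : psi y0 = lastc z by rewrite -graph_pt_center lastc_row_mx.
have := dP (- (tau *: p)); rewrite ntp => /(_ _)/ler_normlP[|_]; first lra.
rewrite psiz edotNr edotZr -/p.
have ep : (1 + enorm p)^-1 * (tau * enorm p) < tau.
  rewrite mulrCA gtr_pMr// mulrC ltr_pdivrMr// mul1r; lra.
have pp : 0 <= tau * edot p p by rewrite mulr_ge0 ?edot_ge0// ltW.
lra.
Qed.

(** The vector from [x0] to the touching point [z] is orthogonal to the graph,
    and it points upwards since the segment from [x0] to [z] is in [Omega]. *)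
Lemma touching_normal x0 : open Omega -> Omega x0 ->
  touching_set (boundary Omega) x0 z ->
  exists2 c, 0 < c & z - x0 = c *: upward p.
Proof.
move=> oO Ox0 /touching_set_le zmin.
have x0z : x0 != z.
  apply/eqP => x0z; have [_ []] := z_boundary; rewrite -x0z.
  exact/open_nbhs_nbhs.
have orth h : edot (tangent p h) (z - x0) = 0.
  rewrite -graph_pt_center; apply: (normal_orthogonal rho_gt0 dpsi) => y By.
  rewrite graph_pt_center; apply: zmin.
  suff : (boundary Omega `&` cylinder y0 rho a b) (graph_pt psi y) by case.
  by rewrite boundary_graph; exists y.
pose c := lastc (z - x0); pose v := lsubmx (z - x0).
have vE : z - x0 = c *: upward p.
  have vc : v + c *: p = 0.
    apply: enorm_eq0; rewrite /enorm -[RHS]sqrtr0; congr Num.sqrt.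
    have := orth (v + c *: p); rewrite {1}(row_mx_lastc (z - x0)) -/v -/c.
    by rewrite /tangent edot_row_mx (edotC p) mulrC -edotZr -edotDr.
  rewrite (row_mx_lastc (z - x0)) -/v -/c /upward scale_row_mx scale_scalar_mx.
  by rewrite mulr1 scalerN (addr0_eq (_ : c *: p + v = 0)) ?opprK// addrC.
exists c => //; rewrite ltNge; apply/negP; rewrite le_eqVlt => /predU1P[c0|c0].
  move: vE; rewrite c0 scale0r => /eqP; rewrite subr_eq0 => /eqP zx.
  by rewrite zx eqxx in x0z.
have [tau0 tau00 tauP] := upward_outside.
pose l := Num.min 1 (tau0 / (2 * - c)).
have l0 : 0 < l by rewrite lt_min ltr01 divr_gt0// mulr_gt0// oppr_gt0.
have l1 : l <= 1 by rewrite ge_min lexx.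
have lc : l * - c < tau0.
  have : l * - c <= tau0 / (2 * - c) * - c.
    by rewrite ler_wpM2r ?ge_min ?lexx ?orbT// oppr_ge0 ltW.
  move=> /le_lt_trans; apply.
  have -> : tau0 / (2 * - c) * - c = tau0 / 2 by field; rewrite lt_eqF.
  by rewrite ltr_pdivrMr// ltr_pMr// ltr1n.
apply: (tauP (l * - c)); first by rewrite lc mulr_gt0// oppr_gt0.
apply: subset_closure.
have -> : z + l * - c *: upward p = x0 + (1 - l) *: (z - x0).
  rewrite scalerBl scale1r [x0 + _]addrA [x0 + _]addrC subrK vE scalerA.
  by rewrite mulrN scaleNr.
apply: segment_touching => //.
by rewrite subr_ge0 l1 gtrBl.
Qed.

End outside_points.

(** * Flat and non-flat parts of a graph *)

Section flat_part.
Context {R : realType} {n : nat}.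
Local Notation k := n.+1.
Variables (psi : 'rV[R]_k -> R) (y0 p : 'rV[R]_k) (rho : R).
Implicit Types (y : 'rV[R]_k) (e kappa t M : R).

(** The factor 2 makes the condition hold for small [kappa] at every point where
    the gradient is within [e] of [p]. *)
Definition flat_at e kappa y := forall y', eball y0 rho y' ->
  enorm (y' - y) < kappa ->
  `|psi y' - psi y - edot p (y' - y)| <= 2 * e * enorm (y' - y).

Definition nonflat e kappa t M : set 'rV[R]_k := [set xi | [/\ enorm xi < M,
  eball y0 rho (y0 + t *: xi) & ~ flat_at e kappa (y0 + t *: xi)]].

Hypothesis lip : [lipschitz psi y | y in eball y0 rho].

(** The inequality violated by some [y'] is strict, and both of its sides are
    Lipschitz functions of [y]. *)
Lemma open_nonflat e kappa t M : 0 <= e -> 0 < t -> open (nonflat e kappa t M).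
Proof.
move=> e0 t0; have [C C0 CP] := lipschitz_graph lip.
rewrite openE => xi [xiM By /existsNP[y' /not_implyP[By' /not_implyP[yk]]]].
move/negP; rewrite -ltNge => gap.
set y := y0 + t *: xi in By yk gap *.
set E := `|_| in gap.
pose c := Num.min (Num.min (M - enorm xi) (rho - enorm (y - y0)))
  (Num.min (kappa - enorm (y' - y)) (E - 2 * e * enorm (y' - y))).
(* Moving [xi] by [D] moves [y] by [t * D], and the two sides of the inequality
   by at most [(C + enorm p + 2 * e) * t * D] altogether; [L * D] dominates all
   these displacements. *)
pose L := 1 + t + (C + enorm p + 2 * e) * t.
have pe0 : 0 <= (C + enorm p + 2 * e) * t.
  by rewrite mulr_ge0 ?(ltW t0)// !addr_ge0 ?enorm_ge0 ?mulr_ge0 ?(ltW C0).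
have L0 : 0 < L by rewrite /L; lra.
have c0 : 0 < c by rewrite !lt_min !subr_gt0 xiM By yk gap.
apply/nbhs_eball; exists (c / L); first by rewrite divr_gt0.
move=> xi1; rewrite /eball/= ltr_pdivlMr// mulrC.
set D := enorm (xi1 - xi) => LD.
have D0 : 0 <= D by exact: enorm_ge0.
have yE : (y0 + t *: xi1) - y = t *: (xi1 - xi).
  by rewrite /y opprD addrACA subrr add0r scalerBr.
have yD : enorm ((y0 + t *: xi1) - y) = t * D.
  by rewrite yE enormZ gtr0_norm.
have tD0 : 0 <= t * D by rewrite mulr_ge0// ltW.
have peD0 : 0 <= (C + enorm p + 2 * e) * t * D by rewrite mulr_ge0.
move: LD; rewrite /L /c !mulrDl mul1r !lt_min
  => /andP[/andP[LD1 LD2] /andP[LD3 LD4]].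
have B1 : eball y0 rho (y0 + t *: xi1).
  have := enorm_distD y (y0 + t *: xi1) y0; rewrite yD /eball/=; lra.
have y1y' : enorm (y' - (y0 + t *: xi1)) <= enorm (y' - y) + t * D.
  by apply: le_trans (enorm_distD y _ _) _; rewrite [X in _ + X]enormB yD.
split=> //.
  have := enormD xi (xi1 - xi); rewrite addrC subrK -/D; lra.
move=> /(_ y' By'); have -> : enorm (y' - (y0 + t *: xi1)) < kappa by lra.
move=> /(_ isT); apply/negP; rewrite -ltNge.
set y1 := y0 + t *: xi1 in B1 yD y1y' *.
have [psiD _] := CP _ _ B1 By.
have pD : `|edot p (y1 - y)| <= enorm p * (t * D) by rewrite -yD edot_le.
have EE : E <= `|psi y' - psi y1 - edot p (y' - y1)| + C * (t * D) + enorm p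
  * (t * D).
  have -> : E = `|(psi y' - psi y1 - edot p (y' - y1)) + (psi y1 - psi y) - edot
    p (y1 - y)|.
    by rewrite /E; congr `|_|; rewrite !edotBr; ring.
  rewrite (le_trans (ler_normB _ _))// lerD// (le_trans (ler_normD _ _))//
    lerD//.
  by rewrite -yD.
have : 2 * e * enorm (y' - y1) <= 2 * e * (enorm (y' - y) + t * D).
  by rewrite ler_wpM2l// mulr_ge0.
move: LD4; rewrite !mulrDl -!mulrA; lra.
Qed.

Hypotheses (rho_gt0 : 0 < rho).
Hypothesis dpsi : forall y, eball y0 rho y -> differentiable psi y.
Hypothesis ae_cvg : lebesgue_ae (fun xi =>
  gradient psi (y0 + t *: xi) @[t --> (0 : R)^'] --> p).

(** Along almost every ray towards [y0] the gradient ends up close to [p], and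
    a point with such a gradient is flat at some scale. The conclusion follows
    by continuity from above of Lebesgue measure, used first for [t] tending to
    [0] and then, at fixed [t], for [kappa] tending to [0]. *)
Lemma nonflat_small e M b tau : 0 < e -> 0 < b -> 0 < tau ->
  exists t kappa, [/\ 0 < t <= tau, 0 < kappa &
    (lebesgue_outer (nonflat e kappa t M) <= b%:E)%E].
Proof.
move=> e0 b0 tau0.
pose mu0 : {outer_measure set 'rV[R]_k -> \bar R} := @lebesgue_outer R k.
pose mu : {measure set (caratheodory_type mu0) -> \bar R} :=
  (mu0 : set (caratheodory_type mu0) -> \bar R).
pose t (i : nat) : R := tau / i.+1%:R.
have t0 i : 0 < t i by rewrite divr_gt0// ltr0n.
pose N i j : set (caratheodory_type mu0) :=
  nonflat e j.+1%:R^-1 (t i) M.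
have mN i j : measurable (N i j).
  by apply: open_caratheodory; apply: open_nonflat => //; exact: ltW.
have N_noninc i : nonincreasing_seq (N i).
  move=> j j' jj'; apply/subsetPset => xi [xiM Bxi nf]; split=> // fl;
    apply: nf.
  move=> y' By' y'j; apply: fl => //; apply: lt_le_trans y'j _.
  by rewrite lef_pV2 ?posrE ?ltr0n// ler_nat ltnS.
(* [O i] is the set of points that are flat at no scale for [t i]. *)
pose O i := \bigcap_j N i j.
have mO i : measurable (O i) by exact: bigcapT_measurable.
pose U i := \bigcup_(j in [set j | (i <= j)%N]) O j.
have mU i : measurable (U i) by exact: bigcup_measurable.
have U_noninc : nonincreasing_seq U.
  move=> i i' ii'; apply/subsetPset => xi [j /= ij Oj]; exists j => //=.
  exact: leq_trans ij.
have sub_ball (A : set 'rV[R]_k) : A `<=` eball 0 M -> (mu A < +oo)%E.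
  move=> AM; have [M0|M0] := leP 0 M.
    apply: le_lt_trans (le_lebesgue_outer AM) _.
    by rewrite lebesgue_outer_eball ?ltry.
  suff -> : A = set0 by rewrite measure0.
  rewrite -subset0 => x /AM; rewrite /eball/= => xM.
  by move: (lt_trans xM M0); rewrite ltNge enorm_ge0.
have NM i j : N i j `<=` eball 0 M by move=> xi [xiM _ _];
  rewrite /eball/= subr0.
have capU : mu (\bigcap_i U i) = 0%E.
  apply/eqP; rewrite eq_le measure_ge0 andbT -[leRHS]ae_cvg.
  apply: le_lebesgue_outer => xi Uxi; rewrite /= => cvg_xi.
  have /cvgr_dist_lt/(_ (e / k%:R)) : gradient psi (y0 + t *: xi)
    @[t --> (0 : R)^'] --> p by [].
  rewrite divr_gt0 ?ltr0n// => /(_ isT)[d /= d0 dP].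
  have [i iP] : exists i, forall j, (i <= j)%N -> t j < d.
    exists (Num.trunc (tau / d)) => j ij.
    rewrite ltr_pdivrMr ?ltr0n// mulrC -ltr_pdivrMr//.
    have /andP[_ /lt_le_trans] := truncn_itv (ltW (divr_gt0 tau0 d0)); apply.
    by rewrite ler_nat ltnS.
  have [j /= /iP tjd Oj] := Uxi i Logic.I.
  have [_ By _] := Oj 0%N Logic.I.
  set y := y0 + t j *: xi in By.
  have grad : enorm (gradient psi y - p) <= e.
    apply: le_trans (enorm_le_mx_norm _) _.
    rewrite mulrC -ler_pdivlMr ?ltr0n// -normrN opprB ltW//; apply: dP.
      by rewrite /ball_/= sub0r normrN gtr0_norm.
    by rewrite gt_eqF.
  have [d1 d10 d1P] := gradient_approx (dpsi By) e0.
  have [j1 j1d] : exists j1 : nat, j1.+1%:R^-1 < d1.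
    exists (Num.trunc d1^-1); rewrite invf_plt ?posrE ?ltr0n//.
    by have /andP[] := truncn_itv (ltW (etrans (invr_gt0 d1) d10)).
  have [_ _] := Oj j1 Logic.I; apply=> y' By' y'y; rewrite -/y.
  have := d1P (y' - y); rewrite [y + _]addrC subrK => /(_ (lt_trans y'y j1d)).
  move=> h1.
  have h2 : `|edot (gradient psi y - p) (y' - y)| <= e * enorm (y' - y).
    by apply: le_trans (edot_le _ _) _; rewrite ler_wpM2r// enorm_ge0.
  rewrite -mulrA mulr2n mulrDl mul1r.
  have -> : psi y' - psi y - edot p (y' - y) =
      (psi y' - psi y - edot (gradient psi y) (y' - y)) + edot
        (gradient psi y - p) (y' - y).
    by rewrite edotBl; ring.
  by rewrite (le_trans (ler_normD _ _))// lerD.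
have b20 : (0 < b / 2)%R by rewrite divr_gt0.
have [i Ui] : exists i, (mu (U i) < (b / 2)%:E)%E.
  have : mu \o U @ \oo --> (0 : \bar R)%E.
    rewrite -capU; apply: nonincreasing_cvg_mu => //.
      by apply: sub_ball => xi [j _ Oj]; exact: (NM j 0%N) (Oj 0%N Logic.I).
    exact: bigcapT_measurable.
  move=> /fine_cvgP[[j _ jfin]] /cvgrPdist_lt/(_ _ b20)[j' _ j'P].
  exists (maxn j j'); have /= := j'P (maxn j j') (leq_maxr _ _).
  rewrite sub0r normrN ger0_norm ?fine_ge0 ?lebesgue_outer_ge0// => h.
  apply: (@le_lt_trans _ _ (fine (mu (U (maxn j j'))))%:E);
    last by rewrite lte_fin.
  by rewrite fineK//; apply: jfin; exact: leq_maxl.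
have Oi : (mu (O i) < (b / 2)%:E)%E.
  apply: le_lt_trans Ui; apply: le_lebesgue_outer => xi Oxi.
  by exists i => //=.
have [j Nj] : exists j, (mu (N i j) <= b%:E)%E.
  have : mu \o N i @ \oo --> mu (O i).
    by apply: nonincreasing_cvg_mu => //; [exact/sub_ball/NM|exact: mO].
  have Ofin : mu (O i) = (fine (mu (O i)))%:E.
    by rewrite fineK// ge0_fin_numE ?measure_ge0// (lt_trans Oi)// ltry.
  rewrite Ofin => /fine_cvgP[[j _ jfin]] /cvgrPdist_lt/(_ _ b20)[j' _ j'P].
  exists (maxn j j'); have /= := j'P (maxn j j') (leq_maxr _ _).
  have h : fine (mu (O i)) < b / 2 by rewrite -lte_fin; apply: le_lt_trans Oi;
    rewrite -Ofin.
  rewrite ltr_norml => /andP[h1 h2].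
  apply: (@le_trans _ _ (fine (mu (N i (maxn j j'))))%:E).
    by rewrite fineK//; apply: jfin; exact: leq_maxl.
  by rewrite lee_fin; lra.
exists (t i), j.+1%:R^-1; split=> //.
by rewrite t0 /= ler_pdivrMr ?ltr0n// ler_peMr ?ler1n// ltW.
Qed.

End flat_part.

Section graph_pieces.
Context {R : realType} {n : nat}.
Local Notation k := n.+1.
Variables (psi : 'rV[R]_k -> R) (y0 p : 'rV[R]_k) (rho C : R).
Hypothesis C_gt0 : 0 < C.
Hypothesis graph_lip : forall y y', eball y0 rho y -> eball y0 rho y' ->
  enorm (graph_pt psi y - graph_pt psi y') <= C * enorm (y - y').
Implicit Types (e kappa t lo hi M b : R) (y : 'rV[R]_k).

Let hausdorff_scaled_graph (E : set 'rV[R]_k) t : 0 < t ->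
  (forall xi, E xi -> eball y0 rho (y0 + t *: xi)) ->
  (hausdorff k ((fun xi => graph_pt psi (y0 + t *: xi)) @` E) <=
   ((C * t) ^+ k)%:E * lebesgue_outer E)%E.
Proof.
move=> t0 EB; apply: (hausdorff_lipschitz_image _ ltr01); first exact: mulr_gt0.
move=> xi xi' Exi Exi' _; apply: le_trans (graph_lip (EB _ Exi) (EB _ Exi')) _.
rewrite opprD addrACA subrr add0r -scalerBr enormZ gtr0_norm//.
by rewrite mulrA.
Qed.

Let scale_back t y : 0 < t -> y0 + t *: (t^-1 *: (y - y0)) = y.
Proof. by move=> t0; rewrite scalerA mulfV ?gt_eqF// scale1r addrC subrK. Qed.

Lemma hausdorff_graph_disk t hi : 0 < t -> 0 <= hi ->
  (hausdorff k [set graph_pt psi y | y in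
     [set y | eball y0 rho y /\ (enorm (tangent p (y - y0)) < t * hi)%R]] <=
   ((C * t) ^+ k * (omega R k * hi ^+ k))%:E)%E.
Proof.
move=> t0 hi0.
pose E : set 'rV[R]_k := [set xi | eball y0 rho (y0 + t *: xi) /\ enorm xi <
  hi].
apply: (@le_trans _ _ (hausdorff k
  ((fun xi => graph_pt psi (y0 + t *: xi)) @` E))).
  apply: le_hausdorff => _ [y [By yt] <-]; exists (t^-1 *: (y - y0));
    last first.
    by rewrite scale_back.
  split; first by rewrite scale_back.
  rewrite enormZ gtr0_norm ?invr_gt0// mulrC ltr_pdivrMr// mulrC.
  exact: le_lt_trans (enorm_le_row_mx _ _) yt.
apply: le_trans (hausdorff_scaled_graph t0 _) _; first by move=> xi [].
rewrite EFinM lee_wpmul2l ?lee_fin ?exprn_ge0 ?mulr_ge0 ?(ltW C_gt0)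
  ?(ltW t0)//.
rewrite -(lebesgue_outer_eball (0 : 'rV[R]_k))//;
  apply: le_lebesgue_outer => xi [_].
by rewrite /eball/= subr0.
Qed.

Lemma hausdorff_graph_nonflat e kappa t M b : 0 < t ->
  (lebesgue_outer (nonflat psi y0 p rho e kappa t M) <= b%:E)%E ->
  (hausdorff k [set graph_pt psi y | y in
     [set y | [/\ eball y0 rho y, ~ flat_at psi y0 p rho e kappa y &
                 (enorm (tangent p (y - y0)) < t * M)%R]]] <=
   ((C * t) ^+ k * b)%:E)%E.
Proof.
move=> t0 nb; set E := nonflat _ _ _ _ _ _ _ _ in nb.
apply: (@le_trans _ _ (hausdorff k
  ((fun xi => graph_pt psi (y0 + t *: xi)) @` E))).
  apply: le_hausdorff => _ [y [By nf yt] <-]; exists (t^-1 *: (y - y0));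
    last first.
    by rewrite scale_back.
  split; rewrite ?scale_back//.
  rewrite enormZ gtr0_norm ?invr_gt0// mulrC ltr_pdivrMr// mulrC.
  exact: le_lt_trans (enorm_le_row_mx _ _) yt.
apply: le_trans (hausdorff_scaled_graph t0 _) _; first by move=> xi [].
by rewrite EFinM lee_wpmul2l ?lee_fin ?exprn_ge0 ?mulr_ge0 ?(ltW C_gt0)
  ?(ltW t0).
Qed.

(** Read in isometric coordinates of the hyperplane of slope [p], the flat part
    of the graph is an almost isometric image. *)
Lemma hausdorff_graph_flat e kappa t lo hi : 0 < e -> 0 < kappa -> 0 < t ->
  0 <= lo -> lo <= hi ->
  (hausdorff k [set graph_pt psi y | y in
     [set y | [/\ eball y0 rho y, flat_at psi y0 p rho e kappa y &
                 (t * lo <= enorm (tangent p (y - y0)) < t * hi)%R]]] <=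
   (((1 + 2 * e) * t) ^+ k * (omega R k * (hi ^+ k - lo ^+ k)))%:E)%E.
Proof.
move=> e0 ka0 t0 lo0 lohi.
have [A [B [AB BB BZ BN AN]]] := tangent_isometry p.
have Bxi_le xi : enorm (B xi) <= enorm xi.
  by rewrite -[leRHS]BN; exact: enorm_le_row_mx.
pose f xi := graph_pt psi (y0 + t *: B xi).
pose E : set 'rV[R]_k := [set xi | [/\ eball y0 rho (y0 + t *: B xi),
  flat_at psi y0 p rho e kappa (y0 + t *: B xi) & lo <= enorm xi < hi]].
have e20 : 0 < 1 + 2 * e by rewrite addr_gt0// mulr_gt0.
apply: (@le_trans _ _ (hausdorff k (f @` E))).
  apply: le_hausdorff => _ [y [By fy /andP[ylo yhi]] <-].
  have yE : y0 + t *: B (t^-1 *: A (y - y0)) = y by rewrite BZ AB scale_back.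
  exists (t^-1 *: A (y - y0)); last by rewrite /f yE.
  split; rewrite ?yE//.
  rewrite enormZ gtr0_norm ?invr_gt0// AN mulrC.
  by rewrite ltr_pdivrMr// ler_pdivlMr// ![_ * t]mulrC ylo yhi.
apply: (@le_trans _ _ ((((1 + 2 * e) * t) ^+ k)%:E * lebesgue_outer E)%E).
  (* At this scale, [f] compares points of the graph over points at distance
     less than [kappa], one of which is flat. *)
  apply: (@hausdorff_lipschitz_image _ _ _ _ _ _ (kappa / (2 * t))).
  - exact: mulr_gt0.
  - by rewrite divr_gt0// mulr_gt0.
  move=> xi xi' [B1 _ _] [B2 F2 _] dxi.
  have dE : (y0 + t *: B xi) - (y0 + t *: B xi') = t *: B (xi - xi').
    by rewrite opprD addrACA subrr add0r -scalerBr BB.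
  have dN : enorm ((y0 + t *: B xi) - (y0 + t *: B xi')) <= t * enorm
    (xi - xi').
    by rewrite dE enormZ gtr0_norm// ler_pM2l.
  have small : enorm ((y0 + t *: B xi) - (y0 + t *: B xi')) < kappa.
    apply: le_lt_trans dN _.
    have : t * enorm (xi - xi') <= t * (kappa / (2 * t)) by rewrite ler_pM2l.
    have -> : t * (kappa / (2 * t)) = kappa / 2 by field; rewrite gt_eqF.
    by move=> /le_lt_trans; apply; rewrite ltr_pdivrMr// ltr_pMr// ltr1n.
  have h := graph_tangent_dist (F2 _ B1 small).
  rewrite /f -[X in enorm X](subrK (tangent p (t *: B (xi - xi')))) -dE.
  apply: le_trans (enormD _ _) _; apply: le_trans (lerD h (lexx _)) _.
  rewrite [X in tangent p X]dE tangentZ enormZ gtr0_norm// BN.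
  have : 2 * e * enorm ((y0 + t *: B xi) - (y0 + t *: B xi')) <=
      2 * e * (t * enorm (xi - xi')) by rewrite ler_wpM2l// mulr_ge0// ltW.
  move=> h'; apply: le_trans (lerD h' (lexx _)) _.
  by rewrite le_eqVlt; apply/orP; left; apply/eqP; ring.
rewrite EFinM lee_wpmul2l ?lee_fin ?exprn_ge0 ?mulr_ge0 ?(ltW e20) ?(ltW t0)//.
rewrite -lebesgue_outer_annulus//;
  apply: le_lebesgue_outer => xi [_ _ /andP[xlo xhi]].
by rewrite /eball/=; split; rewrite /= subr0//; apply/negP; rewrite -leNgt.
Qed.

End graph_pieces.

(** * The kernel near a touching point *)

Section kernel_estimate.
Context {R : realType} {m : nat}.
Variables (psi : 'rV[R]_m -> R) (y0 p y : 'rV[R]_m) (x0 : 'rV[R]_(m + 1)).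
Variables (e t s hi : R).
Let z := graph_pt psi y0.
Let v := z - x0.
Let r := enorm v.
Let x := graph_pt psi y.
Let N := enorm (tangent p (y - y0)).
Let alpha := z + (t / r) *: v.
Hypotheses (r_gt0 : 0 < r) (e_gt0 : 0 < e) (e_lt1 : e < 1).
Hypotheses (t_gt0 : 0 < t) (s_gt0 : 0 < s) (hi_ge0 : 0 <= hi).
Hypothesis orth : forall h, edot (tangent p h) v = 0.
Hypothesis approx : `|psi y - psi y0 - edot p (y - y0)| <= e * enorm (y - y0).
Hypothesis xr : r <= enorm (x - x0).
Hypotheses (N_lo : (t / s) ^+ 2 <= t ^+ 2 + N ^+ 2) (N_hi : N <= t * hi).

Let vv : edot v v = r ^+ 2. Proof. by rewrite enorm_sqr. Qed.

Let w_tangent : enorm ((x - z) - tangent p (y - y0)) <= e * N.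
Proof.
apply: le_trans (graph_tangent_dist approx) _.
by rewrite ler_wpM2l ?(ltW e_gt0)// /N /tangent enorm_le_row_mx.
Qed.

(** The normal component of [alpha - x] is at most [t] up to a term which is
    quadratic in [x - z], because [x] lies outside of the ball of center [x0]
    through [z]. *)
Let numerator : edot (alpha - x) (alpha - x0) <=
  (r + t) * (t * (1 + 2 * t * hi ^+ 2 / r)).
Proof.
have N0 : 0 <= N by exact: enorm_ge0.
have wN : enorm (x - z) <= 2 * (t * hi).
  rewrite -[X in enorm X](subrK (tangent p (y - y0))) (le_trans (enormD _ _))//.
  rewrite -/N; apply: le_trans (lerD w_tangent (lexx _)) _.
  have eN : e * N <= N by rewrite ler_piMl// ltW.
  rewrite -/N; have := N_hi; lra.
have ww : edot (x - z) (x - z) <= 4 * (t * hi) ^+ 2.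
  rewrite -enorm_sqr (_ : 4 * _ = (2 * (t * hi)) ^+ 2); last by ring.
  by rewrite lerXn2r ?nnegrE ?enorm_ge0// mulr_ge0// mulr_ge0// ltW.
have : 0 <= 2 * edot (x - z) v + edot (x - z) (x - z).
  have := xr; rewrite -(ler_pXn2r (n := 2)) ?nnegrE ?enorm_ge0// -vv enorm_sqr.
  have -> : x - x0 = (x - z) + v by rewrite /v addrA subrK.
  rewrite (edotDl (x - z) v) (edotDr (x - z) (x - z) v) (edotDr v (x - z) v)
    (edotC v (x - z)). lra.
move=> wv.
have -> : alpha - x0 = ((r + t) / r) *: v.
  rewrite /alpha addrAC -/v -[X in X + _]scale1r -scalerDl.
  by congr (_ *: _); field; rewrite gt_eqF.
have -> : alpha - x = (t / r) *: v - (x - z).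
  by rewrite /alpha; apply/rowP => i; rewrite !mxE; ring.
rewrite edotZr (edotBl _ (x - z)) edotZl vv.
have -> : (r + t) / r * (t / r * r ^+ 2 - edot (x - z) v) =
    (r + t) * (t - edot (x - z) v / r) by field; rewrite gt_eqF.
rewrite ler_wpM2l ?addr_ge0 ?(ltW t_gt0) ?(ltW r_gt0)//.
have -> : t * (1 + 2 * t * hi ^+ 2 / r) = t + 2 * (t * hi) ^+ 2 / r.
  by field; rewrite gt_eqF.
rewrite lerD2l -mulNr ler_pM2r ?invr_gt0//; lra.
Qed.

(** Up to a vertical error of size [e * N], the point [x] lies on the tangent
    plane at [z], where Pythagoras applies since [alpha - z] is normal. *)
Let denominator : (1 - e) * t / s <= enorm (x - alpha).
Proof.
set u := tangent p (y - y0).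
have N0 : 0 <= N by exact: enorm_ge0.
have uv : enorm ((t / r) *: v - u) ^+ 2 = t ^+ 2 + N ^+ 2.
  rewrite enorm_sqr (edotBl _ u) !(edotBr _ _ u) !edotZr !edotZl (edotC v u)
    orth vv.
  by rewrite /N -/u enorm_sqr; field; rewrite gt_eqF.
set W := enorm ((t / r) *: v - u) in uv.
have W0 : 0 <= W by exact: enorm_ge0.
have WN : N <= W.
  by rewrite -(ler_pXn2r (n := 2)) ?nnegrE// uv lerDr sqr_ge0.
have Wts : t / s <= W.
  by rewrite -(ler_pXn2r (n := 2)) ?nnegrE ?divr_ge0 ?(ltW t_gt0) ?(ltW s_gt0)//
    uv.
have : W <= enorm (x - alpha) + e * N.
  rewrite /W; have -> : (t / r) *: v - u = - (x - alpha) + ((x - z) - u).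
    by rewrite /alpha; apply/rowP => i; rewrite !mxE; ring.
  by rewrite (le_trans (enormD _ _))// enormN lerD2l.
have : e * N <= e * W by rewrite ler_wpM2l// ltW.
have : (1 - e) * (t / s) <= (1 - e) * W by rewrite ler_wpM2l// subr_ge0 ltW.
rewrite mulrA; lra.
Qed.

(** Pointwise bound of the integrand at the boundary points whose tangential
    distance [N] to [z] is at most [t * hi], and large enough for
    [t ^+ 2 + N ^+ 2] to exceed [(t / s) ^+ 2]. *)
Lemma kernel_le (d : nat) :
  edot (alpha - x) (alpha - x0) / enorm (x - alpha) ^+ d <=
  (r + t) * (t * (1 + 2 * t * hi ^+ 2 / r)) / ((1 - e) * t / s) ^+ d.
Proof.
have d0 : 0 < (1 - e) * t / s by rewrite divr_gt0// mulr_gt0// subr_gt0.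
have x0' : 0 < enorm (x - alpha) by exact: lt_le_trans denominator.
have n0 : 0 <= (r + t) * (t * (1 + 2 * t * hi ^+ 2 / r)).
  rewrite mulr_ge0 ?addr_ge0 ?(ltW t_gt0) ?(ltW r_gt0)//
    mulr_ge0 ?(ltW t_gt0)//.
  by rewrite addr_ge0// divr_ge0 ?(ltW r_gt0)// mulr_ge0 ?sqr_ge0// mulr_ge0//
    ltW.
apply: (@le_trans _ _
    ((r + t) * (t * (1 + 2 * t * hi ^+ 2 / r)) / enorm (x - alpha) ^+ d)).
  by rewrite ler_pM2r ?invr_gt0 ?exprn_gt0.
rewrite ler_wpM2l// lef_pV2 ?posrE ?exprn_gt0//.
by rewrite lerXn2r ?nnegrE ?(ltW d0) ?(ltW x0').
Qed.

End kernel_estimate.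

(** * Summation over the pieces *)

Section sum_over_pieces.
Context {R : realType}.
Variables (q e r t b C w w' sg rad : R) (k K l : nat).
Hypotheses (q_gt0 : 0 < q) (q_lt1 : q < 1) (e_gt0 : 0 < e) (e_lt1 : e < 1).
Hypotheses (r_gt0 : 0 < r) (t_gt0 : 0 < t) (C_ge3 : 3 <= C).
Hypotheses (w_ge0 : 0 <= w) (k_gt0 : (0 < k)%N).
Hypothesis w_sum : 2 * (w *
  \sum_(i < K.+1) Num.sqrt (1 - (q ^+ i) ^+ 2) ^+ k * (q ^+ i - q ^+ i.+1)) <=
    w'.
Hypothesis l_le : (q ^+ l)^-1 <= 1 + sg * rad / t.
Local Notation radius := (geom_radius q).

(** Upper bounds for the kernel and for the Hausdorff measure, respectively, on
    the non-flat part of the graph (index [0]) and on the annulus between the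
    radii [t * radius i] and [t * radius i.+1] (index [i.+1]). *)
Definition kernel_sup (s hi : R) : R :=
  (r + t) * (t * (1 + 2 * t * hi ^+ 2 / r)) / ((1 - e) * t / s) ^+ k.+1.

Definition piece_kernel (i : nat) : R :=
  if i is j.+1 then kernel_sup (q ^+ j) (radius j.+1) else kernel_sup 1
    (radius K).

Definition piece_measure (i : nat) : R :=
  if i is j.+1 then
    if (j < K)%N then ((1 + 2 * e) * t) ^+ k
      * (w * (radius j.+1 ^+ k - radius j ^+ k))
    else (C * t) ^+ k * (w * radius j.+1 ^+ k)
  else (C * t) ^+ k * b.

Let D := (r + t) / (1 - e) ^+ k.+1.

Let e1 : 0 < 1 - e. Proof. by rewrite subr_gt0. Qed.

Let D_ge0 : 0 <= D.
Proof. by rewrite divr_ge0 ?addr_ge0 ?exprn_ge0 ?(ltW r_gt0) ?(ltW t_gt0)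
  ?(ltW e1). Qed.

Let kernel_supE s hi : 0 < s ->
  kernel_sup s hi = D * (s ^+ k.+1 * (1 + 2 * t * hi ^+ 2 / r) / t ^+ k).
Proof.
move=> s0; rewrite /kernel_sup /D expr_div_n exprMn [t ^+ k.+1]exprS.
have t0 := lt0r_neq0 t_gt0; have r0 := lt0r_neq0 r_gt0.
move: (lt0r_neq0 (exprn_gt0 k t_gt0)) (lt0r_neq0 (exprn_gt0 k.+1 e1))
  (lt0r_neq0 (exprn_gt0 k.+1 s0)).
move: (t ^+ k) ((1 - e) ^+ k.+1) (s ^+ k.+1) => T E S T0 E0 S0.
by field; rewrite T0 E0 S0 t0 r0.
Qed.

Let radius_pow_le j d : radius j.+1 ^+ d <= (q ^+ j.+1)^-1 ^+ d.
Proof.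
rewrite lerXn2r ?nnegrE ?geom_radius_ge0 ?geom_radius_le_inv//.
by rewrite invr_ge0 exprn_ge0// ltW.
Qed.

Let C_ge0 : 0 <= C. Proof. exact: le_trans C_ge3. Qed.

Let good j := (1 + 2 * e) ^+ k * (w
  * ((q ^+ j) ^+ k.+1 * (radius j.+1 ^+ k - radius j ^+ k))).
Let far j := C ^+ k * w / q ^+ k * q ^+ j.
Let error j := C ^+ k * w * (2 * t / r) / q ^+ k.+2 * (q ^+ j)^-1.

(** The constant [C] exceeds [1 + 2 * e], so the crude measure bound of an
    annulus may be used in the error term even where the sharp one holds. *)
Let piece_le j : piece_kernel j.+1 * piece_measure j.+1 <=
  D * ((if (j < K)%N then good j else far j) + error j).
Proof.
have q0 := ltW q_gt0; have s0 := qX_gt0 q_gt0 j;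
  rewrite /= kernel_supE// -mulrA ler_wpM2l//.
pose m := if (j < K)%N then (1 + 2 * e) ^+ k
  * (w * (radius j.+1 ^+ k - radius j ^+ k))
  else C ^+ k * (w * radius j.+1 ^+ k).
have Tk0 : t ^+ k != 0 by rewrite expf_neq0// gt_eqF.
have rk_le : radius j ^+ k <= radius j.+1 ^+ k.
  by rewrite lerXn2r ?nnegrE ?geom_radius_ge0 ?geom_radius_le.
have rk0 : 0 <= radius j ^+ k by rewrite exprn_ge0// geom_radius_ge0.
have m_le : 0 <= m <= C ^+ k * (w * radius j.+1 ^+ k).
  have C0 : 0 <= C ^+ k by rewrite exprn_ge0.
  have e20 : 0 <= 1 + 2 * e by rewrite addr_ge0// mulr_ge0// ltW.
  rewrite /m; case: ifP => _; last by rewrite lexx andbT !mulr_ge0// exprn_ge0//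
    geom_radius_ge0.
  rewrite !mulr_ge0 ?exprn_ge0 ?subr_ge0//=; apply: ler_pM.
  - by rewrite exprn_ge0.
  - by rewrite mulr_ge0// subr_ge0.
  - by rewrite lerXn2r ?nnegrE//; have := C_ge3; have := e_lt1; lra.
  - by rewrite ler_wpM2l// gerBl.
have -> : (if (j < K)%N then ((1 + 2 * e) * t) ^+ k
  * (w * (radius j.+1 ^+ k - radius j ^+ k))
    else (C * t) ^+ k * (w * radius j.+1 ^+ k)) = t ^+ k * m.
  by rewrite /m; case: ifP => _; rewrite exprMn; ring.
have -> : (q ^+ j) ^+ k.+1 * (1 + 2 * t * radius j.+1 ^+ 2 / r) / t ^+ k
  * (t ^+ k * m) =
    (q ^+ j) ^+ k.+1 * m + (2 * t / r)
      * ((q ^+ j) ^+ k.+1 * radius j.+1 ^+ 2 * m).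
  by field; rewrite Tk0 gt_eqF.
have qkE d : (q ^+ j.+1)^-1 ^+ d = (q ^+ j)^-1 ^+ d / q ^+ d.
  by rewrite exprS invfM exprMn mulrC [q^-1 ^+ d]exprVn.
have sk0 := exprn_gt0 k s0; have qk0 := exprn_gt0 k q_gt0.
apply: lerD.
  rewrite /m; case: ifP => _; first by rewrite /good mulrCA ler_wpM2l ?exprn_ge0
    ?addr_ge0 ?mulr_ge0 ?(ltW e_gt0)// mulrCA.
  have : radius j.+1 ^+ k <= (q ^+ j)^-1 ^+ k / q ^+ k by rewrite -qkE
    radius_pow_le.
  move=> h; have -> : far j = (q ^+ j) ^+ k.+1
    * (C ^+ k * (w * ((q ^+ j)^-1 ^+ k / q ^+ k))).
    rewrite /far exprVn [(q ^+ j) ^+ k.+1]exprS.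
    by field; rewrite !gt_eqF.
  by rewrite ler_wpM2l ?exprn_ge0 ?(ltW s0)// ler_wpM2l ?exprn_ge0// ler_wpM2l.
have -> : error j = (2 * t / r)
  * ((q ^+ j) ^+ k.+1 * (C ^+ k * (w * ((q ^+ j)^-1 ^+ k.+2 / q ^+ k.+2)))).
  rewrite /error exprVn [(q ^+ j) ^+ k.+2]exprS.
  have [r0 q20 s10] : [/\ r != 0, q ^+ k.+2 != 0 & (q ^+ j) ^+ k.+1 != 0].
    by rewrite !expf_neq0 ?gt_eqF.
  by field; rewrite r0 q20 s10 gt_eqF.
rewrite ler_wpM2l ?divr_ge0 ?mulr_ge0 ?(ltW t_gt0) ?(ltW r_gt0)//.
rewrite -mulrA ler_wpM2l ?exprn_ge0 ?(ltW s0)//.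
have /andP[m0 mle] := m_le.
apply: (@le_trans _ _ (radius j.+1 ^+ 2 * (C ^+ k * (w * radius j.+1 ^+ k)))).
  by rewrite ler_wpM2l// sqr_ge0.
have -> : radius j.+1 ^+ 2 * (C ^+ k * (w * radius j.+1 ^+ k)) =
    C ^+ k * (w * radius j.+1 ^+ k.+2) by rewrite -(addn2 k) exprD; ring.
by rewrite ler_wpM2l ?exprn_ge0// ler_wpM2l// -qkE radius_pow_le.
Qed.

Let sum_if_le (g h : nat -> R) L : (forall i, 0 <= g i) ->
  \sum_(i < L) (if (i < K)%N then g i else h i) <=
  \sum_(i < K) g i + \sum_(K <= i < L) h i.
Proof.
move=> g0; rewrite -(big_mkord xpredT
  (fun i => if (i < K)%N then g i else h i)).
rewrite -(big_mkord xpredT g).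
have [LK|KL] := leqP L K.
  rewrite [X in _ + X]big_geq// addr0 (big_cat_nat _ LK)//=.
  rewrite [leLHS](eq_big_nat _ _ (F2 := g)) => [|i /andP[_ iL]]; last first.
    by rewrite (leq_trans iL LK).
  by rewrite lerDl sumr_ge0.
rewrite (big_cat_nat _ (ltnW KL))//= le_eqVlt; apply/orP; left; apply/eqP.
congr (_ + _); apply: eq_big_nat => i /andP[h1 h2]; first by rewrite h2.
by rewrite ltnNge h1.
Qed.

(** The four terms come respectively from the flat annuli, from the annuli
    beyond the index [K], from the quadratic part of the kernel, whose sum over
    the annuli is proportional to the diameter of the region, and from the
    non-flat part. *)
Lemma sum_pieces_le : \sum_(i < l.+2) piece_kernel i * piece_measure i <=
  (r + t) / (1 - e) ^+ k.+1 *
  ((1 + 2 * e) ^+ k * (w * q ^+ K + k.+1%:R / q ^+ k.+1 * (w' / 2)) +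
   C ^+ k * w / q ^+ k / (1 - q) * q ^+ K +
   C ^+ k * w * (2 / r) / q ^+ k.+2 / (1 - q) * (t + sg * rad) +
   C ^+ k * b * (1 + 2 * t * radius K ^+ 2 / r)).
Proof.
rewrite big_ord_recl -/D.
have -> : piece_kernel 0%N * piece_measure 0%N =
    D * (C ^+ k * b * (1 + 2 * t * radius K ^+ 2 / r)).
  rewrite /= kernel_supE// expr1n [(C * t) ^+ k]exprMn.
  have Tk0 : t ^+ k != 0 by rewrite expf_neq0// gt_eqF.
  by field; rewrite Tk0 gt_eqF.
apply: (@le_trans _ _ (D * (C ^+ k * b * (1 + 2 * t * radius K ^+ 2 / r)) +
    \sum_(i < l.+1) D * ((if (i < K)%N then good i else far i) + error i))).
  by rewrite lerD2l; apply: ler_sum => i _; exact: piece_le.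
rewrite -mulr_sumr -mulrDr ler_wpM2l// addrC lerD2r big_split/=.
have C0 : 0 <= C ^+ k by rewrite exprn_ge0.
have q1 : 0 < 1 - q by rewrite subr_gt0.
have good0 i : 0 <= good i.
  apply: mulr_ge0; first by rewrite exprn_ge0// addr_ge0// mulr_ge0// ltW.
  apply: mulr_ge0 => //; apply: mulr_ge0; first by rewrite !exprn_ge0// ltW.
  by rewrite subr_ge0 lerXn2r ?nnegrE ?geom_radius_ge0 ?geom_radius_le.
apply: lerD.
  apply: le_trans (sum_if_le _ _ good0) _; apply: lerD.
    rewrite -mulr_sumr ler_wpM2l ?exprn_ge0 ?addr_ge0 ?mulr_ge0 ?(ltW e_gt0)//.
    rewrite -mulr_sumr.
    apply: le_trans (ler_wpM2l w_ge0 (sum_geom_radius_le q_gt0 q_lt1 k_gt0 K))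
      _.
    rewrite mulrDr lerD2l mulrCA ler_wpM2l ?divr_ge0 ?exprn_ge0 ?(ltW q_gt0)//.
    by rewrite ler_pdivlMr// mulrC.
  rewrite -mulr_sumr -[leRHS]mulrA ler_wpM2l ?divr_ge0 ?mulr_ge0 ?exprn_ge0
    ?(ltW q_gt0)//.
  by rewrite mulrC; exact: sum_qX_tail_le.
rewrite -mulr_sumr.
apply: le_trans (ler_wpM2l _ (sum_qXV_le q_gt0 q_lt1 l)) _.
  by rewrite !mulr_ge0 ?invr_ge0 ?exprn_ge0 ?mulr_ge0 ?(ltW t_gt0) ?(ltW r_gt0)
    ?(ltW q_gt0).
have tl : t * (q ^+ l)^-1 <= t + sg * rad.
  by rewrite mulrC -ler_pdivlMr// mulrDl divff ?gt_eqF.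
have -> : C ^+ k * w * (2 * t / r) / q ^+ k.+2 * ((q ^+ l)^-1 / (1 - q)) =
    C ^+ k * w * (2 / r) / q ^+ k.+2 / (1 - q) * (t * (q ^+ l)^-1) by ring.
by rewrite ler_wpM2l// !mulr_ge0 ?invr_ge0 ?exprn_ge0 ?(ltW r_gt0) ?(ltW q_gt0)
  ?(ltW q1).
Qed.

End sum_over_pieces.

(** * The local estimate *)

Section local_estimate.
Context {R : realType} {n : nat}.
Local Notation k := n.+1.
Variables (Omega : set 'rV[R]_(k + 1)) (x0 z : 'rV[R]_(k + 1)).
Variables (psi : 'rV[R]_k -> R) (rho a b : R).
Let y0 := lsubmx z.
Let p := gradient psi y0.
Let B := eball y0 rho.
Hypotheses (rho_gt0 : 0 < rho) (zab : a < lastc z < b).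
Hypothesis lip : [lipschitz psi y | y in B].
Hypothesis dpsi : forall y, B y -> differentiable psi y.
Hypothesis ae_cvg : lebesgue_ae (fun xi =>
  gradient psi (y0 + t *: xi) @[t --> (0 : R)^'] --> p).
Hypothesis boundary_graph : boundary Omega `&` cylinder y0 rho a b =
  [set row_mx y (psi y)%:M | y in B].
Hypothesis below_graph : Omega `&` cylinder y0 rho a b =
  [set x | exists y t, [/\ x = row_mx y t%:M, B y, a < t < psi y & psi y < b]].
Hypotheses (oOmega : open Omega) (Omega_x0 : Omega x0).
Hypothesis touch_z : touching_set (boundary Omega) x0 z.
Let r := enorm (z - x0).
Let w := omega R k.
Let w' := omega R (k + 1).

Let By0 : B y0. Proof. by rewrite /B /eball/= subrr enorm0. Qed.

Let graph_z : graph_pt psi y0 = z.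
Proof. by have [? _] := touch_z; apply: graph_pt_center boundary_graph _. Qed.

(** The integral depends on [s] through the type on which its measure lives; so
    the equation [s = k] is substituted as a whole. *)
Let integral_hausdorff s (X : set 'rV[R]_(k + 1)) (f : 'rV[R]_(k + 1) -> \bar R)
  (c : \bar R) :
  s = k -> (integral (hausdorff k : set
    (caratheodory_type (@hausdorff R (k + 1) k)) -> \bar R) X f <= c)%E ->
  (\int[hausdorff_measure s]_(x in X) f x <= c)%E.
Proof. by move=> ->. Qed.

(** The boundary points near [z] are sorted by their tangential distance to
    [z]. *)
Let annulus_index (q N t : R) (L : nat) : 0 <= N -> N < t * geom_radius q L ->
  exists2 i, (i < L)%N & t * geom_radius q i <= N < t * geom_radius q i.+1.
Proof.
move=> N0; elim: L => [|L ih NL].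
  by rewrite geom_radius0 mulr0 ltNge N0.
have [/ih[i iL Ni]|LN] := ltP N (t * geom_radius q L).
  by exists i => //; exact: ltnW.
by exists L => //; rewrite LN.
Qed.

Let geometric_scale (q Y : R) : 0 < q < 1 -> 0 < Y -> exists l,
  (q ^+ l)^-1 <= 1 + Y /\ 1 + Y <= (q ^+ l.+1)^-1.
Proof.
move=> /andP[q0 q1] Y0.
have ex : exists i, 1 + Y <= (q ^+ i)^-1.
  have Y10 : 0 < (1 + Y)^-1 by rewrite invr_gt0 addr_gt0.
  have q_abs : `|q| < 1 by rewrite gtr0_norm.
  have /cvgrPdist_lt/(_ _ Y10)[i _ /(_ i (leqnn i))] := cvg_expr q_abs.
  rewrite sub0r normrN gtr0_norm ?exprn_gt0// => /ltW qi; exists i.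
  by rewrite -[leLHS]invrK lef_pV2 ?posrE ?exprn_gt0.
case: (ex_minnP ex) => -[|l] lP lmin.
  by move: lP; rewrite expr0 invr1 gerDl leNgt Y0.
exists l; split=> //; rewrite leNgt; apply/negP => /ltW /lmin.
by rewrite ltnn.
Qed.

(** The points [alpha] are taken on the normal at [z], at a distance [t] from
    [z] for which most points at distance of order [t] are flat. The constant
    [C3] does not depend on [K], so that its term vanishes as [K] tends to
    infinity. *)
Lemma flatness_integral_le (q e : R) : 0 < q < 1 -> 0 < e < 1 ->
  exists C3, forall K, exists C4 R0, 0 < R0 /\ forall rad, 0 < rad < R0 ->
  forall V, nbhs z V -> exists alpha, [/\ V alpha, ~ closure Omega alpha &
    (flatness_integral Omega x0 z rad alpha <=
     (r * (1 + e) / (1 - e) ^+ k.+1 *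
        ((1 + 2 * e) ^+ k * (w * q ^+ K + k.+1%:R / q ^+ k.+1 * (w' / 2)) +
         C3 * q ^+ K + C4 * rad))%:E)%E].
Proof.
move=> q01 e01; have [/andP[q0 q1] /andP[e0 e1]] := (q01, e01).
have [Bz zmin] : boundary Omega z /\ forall x,
  boundary Omega x -> r <= enorm (x - x0).
  by split; [case: touch_z|exact: touching_set_le touch_z].
have [c c0 zx0] := touching_normal rho_gt0 zab (dpsi By0) boundary_graph
  below_graph Bz oOmega Omega_x0 touch_z.
have [tau0 tau00 outside] := upward_outside rho_gt0 zab (dpsi By0)
  boundary_graph below_graph Bz.
have r0 : 0 < r.
  rewrite /r zx0 enormZ gtr0_norm// mulr_gt0// (lt_le_trans ltr01)//.
  have := coord_le_enorm (upward p) (rshift k 0).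
  by rewrite row_mxEr mxE eqxx mulr1n normr1.
have orth h : edot (tangent p h) (z - x0) = 0.
  by rewrite zx0 edotZr /tangent edot_upward subrr mulr0.
have [Cl Cl0 ClP] := lipschitz_graph lip.
(* [sum_pieces_le] needs [3 <= C]. *)
pose C := Cl + 3.
have C3 : 3 <= C by rewrite /C lerDr ltW.
have C0 : 0 < C by rewrite (lt_le_trans _ C3).
have glip y y' : B y -> B y' ->
    enorm (graph_pt psi y - graph_pt psi y') <= C * enorm (y - y').
  move=> By By'; apply: le_trans (ClP _ _ By By').2 _.
  by rewrite ler_wpM2r ?enorm_ge0// /C lerDl.
have [d d0 dP] := gradient_approx (dpsi By0) e0.
have w0 : 0 <= w by exact: omega_ge0.
pose sg := Num.sqrt (1 + edot p p).
have sg0 : 0 < sg by rewrite sqrtr_gt0 ltr_pwDl// edot_ge0.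
have q1' : 0 < 1 - q by rewrite subr_gt0.
exists (C ^+ k * w / q ^+ k / (1 - q)) => K.
pose M := geom_radius q K.
have M0 : 0 <= M by exact: geom_radius_ge0.
exists (C ^+ k * w * (2 / r) / q ^+ k.+2 / (1 - q) * (1 + sg) + 1).
exists (Num.min (Num.min d rho) (Num.min (b - lastc z) (lastc z - a))); split.
  by have /andP[za zb] := zab; rewrite !lt_min d0 rho_gt0 !subr_gt0 za zb.
move=> rad /andP[rad0]; rewrite !lt_min
  => /andP[/andP[radd radrho] /andP[radb rada]].
move=> V /nbhs_eball[ev ev0 evV].
have Ck0 : 0 < C ^+ k by rewrite exprn_gt0.
(* The measure [rad / F] allowed to the non-flat part makes its contribution at
   most [rad]. *)
pose F := C ^+ k * (1 + 2 * rad * M ^+ 2 / r).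
have F0 : 0 < F.
  rewrite mulr_gt0// ltr_pwDl// divr_ge0 ?(ltW r0)// mulr_ge0 ?sqr_ge0//.
  by rewrite mulr_ge0// ltW.
(* The four bounds on [t] make the terms in [t] negligible against [rad] and
   [r], and place [alpha] in [V] and outside of [Omega]. *)
pose tau := Num.min (Num.min rad (e * r))
  (Num.min (ev / 2) (tau0 * r / (2 * c))).
have tau_gt0 : 0 < tau.
  by rewrite !lt_min rad0 mulr_gt0//= !divr_gt0 ?mulr_gt0.
have b0 : 0 < rad / F by rewrite divr_gt0.
have [t [kappa [/andP[t0 ttau] kappa0 nonflat_le]]] :=
  nonflat_small lip dpsi ae_cvg M e0 b0 tau_gt0.
move: ttau; rewrite !le_min => /andP[/andP[trad ter] /andP[tev ttau0]].
have [l [l_le l_ge]] := geometric_scale q01 (divr_gt0 (mulr_gt0 sg0 rad0) t0).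
pose v := z - x0.
pose alpha := z + (t / r) *: v.
exists alpha; split.
- apply: evV; rewrite /eball/= /alpha addrAC subrr add0r enormZ -/r.
  rewrite gtr0_norm ?divr_gt0// divfK ?gt_eqF//.
  by apply: le_lt_trans tev _; rewrite ltr_pdivrMr// ltr_pMr// ltr1n.
- rewrite /alpha /v zx0 scalerA; apply: outside.
  rewrite mulr_gt0 ?divr_gt0//= mulrAC ltr_pdivrMr//.
  have : t * c <= tau0 * r / (2 * c) * c by rewrite ler_pM2r.
  move=> /le_lt_trans; apply.
  have -> : tau0 * r / (2 * c) * c = tau0 * r / 2 by field; rewrite gt_eqF.
  by rewrite ltr_pdivrMr// ltr_pMr ?ltr1n// mulr_gt0.
pose nf y := flat_at psi y0 p rho e kappa y.
pose N y := enorm (tangent p (y - y0)).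
pose annulus i y := t * geom_radius q i <= N y < t * geom_radius q i.+1.
pose A (i : nat) : set 'rV[R]_(k + 1) := if i is j.+1 then
    if (j < K)%N then
      [set graph_pt psi y | y in [set y | [/\ B y, nf y & annulus j y]]]
    else [set graph_pt psi y | y in [set y | B y /\ annulus j y]]
  else [set graph_pt psi y | y in [set y | [/\ B y, ~ nf y & N y < t * M]]].
have XB x : (boundary Omega `&` eball z rad) x -> exists y,
    [/\ x = graph_pt psi y, B y & enorm (y - y0) < rad].
  move=> [bx xz]; have xz' : enorm (row_mx (lsubmx (x - z)) (lastc (x - z))%:M)
    < rad.
    by rewrite -row_mx_lastc.
  have yz : enorm (lsubmx x - y0) < rad.
    apply: le_lt_trans xz'; rewrite (_ : _ - y0 = lsubmx (x - z))
      ?enorm_le_row_mx//.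
    by rewrite /y0 raddfB.
  have lz : `|lastc x - lastc z| < rad.
    apply: le_lt_trans xz; apply: le_trans (coord_le_enorm _ (rshift k 0)).
    by rewrite /lastc !mxE.
  have : (boundary Omega `&` cylinder y0 rho a b) x.
    split=> //; split; first exact: lt_trans yz radrho.
    by move: lz; rewrite ltr_norml => /andP[? ?]; apply/andP; split; lra.
  rewrite boundary_graph => -[y By xE]; exists y; split=> //.
  by move: yz; rewrite -xE row_mxKl.
rewrite /flatness_integral; apply: integral_hausdorff; first by rewrite addn1.
apply: (@le_trans _ _ (\sum_(i < l.+2) piece_kernel q e r t k K i *
    piece_measure q e t (rad / F) C w k K i)%:E).
  apply: (@integral_le_fin_cover _ _ (@hausdorff R (k + 1) k) _ _ _ A).
  - move=> i _; have X0 hi s : 0 < s -> 0 <= hi -> 0 <= kernel_sup e r t k s hi.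
      move=> s0 hi0; apply: divr_ge0; last first.
        by rewrite exprn_ge0// divr_ge0 ?(ltW s0)// mulr_ge0 ?(ltW t0)//
          subr_ge0 ltW.
      apply: mulr_ge0; first by rewrite addr_ge0// ltW.
      apply: mulr_ge0; first exact: ltW.
      rewrite addr_ge0// divr_ge0 ?(ltW r0)// mulr_ge0 ?sqr_ge0// mulr_ge0//.
      exact: ltW.
    by case: i => [|i]; apply: X0; rewrite ?exprn_gt0 ?geom_radius_ge0.
  - move=> x /XB[y [-> By yrad]].
    have Ny : N y < t * geom_radius q l.+1.
      apply: (@lt_le_trans _ _ (sg * rad)).
        by apply: le_lt_trans (enorm_tangent_le _ _) _; rewrite ltr_pM2l.
      rewrite [leRHS]mulrC -ler_pdivrMr//.
      rewrite -(ler_pXn2r (n := 2)) ?nnegrE ?geom_radius_ge0 ?divr_ge0 ?mulr_ge0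
        ?(ltW sg0) ?(ltW rad0) ?(ltW t0)//.
      have Y0 : 0 <= sg * rad / t by rewrite divr_ge0 ?mulr_ge0 ?ltW.
      have : (1 + sg * rad / t) ^+ 2 <= 1 + geom_radius q l.+1 ^+ 2.
        by rewrite geom_radius_sqr// lerXn2r ?nnegrE ?invr_ge0 ?exprn_ge0
          ?(ltW q0) ?addr_ge0.
      have : 0 <= (sg * rad / t) by [].
      rewrite sqrrD expr1n mul1r; lra.
    have [i il Ni] := annulus_index (enorm_ge0 _) Ny.
    have [iK|iK] := boolP (i < K)%N; last first.
      by exists i.+1 => //=; rewrite (negbTE iK); exists y.
    have [fy|nfy] := pselect (nf y).
      by exists i.+1 => //=; rewrite iK; exists y.
    exists 0%N => //; exists y => //; split=> //.
    have /andP[_ /lt_le_trans] := Ni; apply; rewrite ler_pM2l//.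
    have mono : {homo geom_radius q : i j / (i <= j)%N >-> i <= j}.
      by apply: homo_leq => // [u ? ? /le_trans|u];
        [apply|exact: geom_radius_le].
    exact: mono.
  - have kernel y s hi : B y -> boundary Omega (graph_pt psi y) ->
        enorm (y - y0) < rad -> 0 < s -> 0 <= hi ->
        (t / s) ^+ 2 <= t ^+ 2 + N y ^+ 2 -> N y <= t * hi ->
        ((edot (alpha - graph_pt psi y) (alpha - x0) /
          enorm (graph_pt psi y - alpha) ^+ (k + 1))%:E <=
            (kernel_sup e r t k s hi)%:E)%E.
      move=> By bdry yrad s0 hi0 Nlo Nhi; rewrite lee_fin.
      have approx : `|psi y - psi y0 - edot p (y - y0)| <= e * enorm (y - y0).
        have := dP (y - y0) (lt_trans yrad radd).
        by rewrite [y0 + _]addrC subrK.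
      have := @kernel_le _ _ psi y0 p y x0 e t s hi.
      rewrite graph_z -/r -/v -/alpha /kernel_sup.
      move=> /(_ r0 e0 e1 t0 s0 hi0 orth approx (zmin _ bdry) Nlo Nhi
        (k + 1)%N).
      by rewrite [X in _ -> _ <= _ / _ ^+ X](_ : _ = (k + 1)%N) ?addn1.
    have lo_le y j : t * geom_radius q j <= N y -> (t / q ^+ j) ^+ 2 <= t ^+ 2
      + N y ^+ 2.
      move=> h; rewrite exprMn -geom_radius_sqr// mulrDr mulr1 lerD2l -exprMn.
      by rewrite lerXn2r ?nnegrE ?enorm_ge0// mulr_ge0 ?geom_radius_ge0// ltW.
    move=> [|j] x _ Xx.
      move=> [y [By _ Ny] xE]; have [bx _] := Xx.
      have [y' [xE' _ yrad]] := XB _ Xx.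
      have yy' : y' = y by move: xE'; rewrite -xE => /(congr1 lsubmx);
        rewrite !row_mxKl.
      rewrite yy' in yrad; rewrite -xE; rewrite -xE in bx.
      apply: kernel => //; first by rewrite divr1 lerDl sqr_ge0.
      exact: ltW.
    have key y : B y -> annulus j y -> graph_pt psi y = x ->
        ((edot (alpha - x) (alpha - x0) / enorm (x - alpha) ^+ (k + 1))%:E <=
         (piece_kernel q e r t k K j.+1)%:E)%E.
      move=> By /andP[Nlo Nhi] xE; have [bx _] := Xx.
      have [y' [xE' _ yrad]] := XB _ Xx.
      have yy' : y' = y by move: xE'; rewrite -xE => /(congr1 lsubmx);
        rewrite !row_mxKl.
      rewrite yy' in yrad; rewrite -xE; rewrite -xE in bx.
      by apply: kernel => //; rewrite ?exprn_gt0 ?geom_radius_ge0 ?lo_le// ltW.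
    rewrite /=; case: ifP => _ [y]; first by move=> [By _ Ny]; exact: key.
    by move=> [By Ny]; exact: key.
  - move=> [_|j jl] /=; first exact: hausdorff_graph_nonflat.
    case: ifP => _.
      apply: hausdorff_graph_flat => //; first exact: geom_radius_ge0.
      exact: geom_radius_le.
    apply: (le_trans _ (hausdorff_graph_disk p C0 glip t0
      (geom_radius_ge0 q0 j.+1))).
    by apply: le_hausdorff => _ [y [By /andP[_ yj]] <-]; exists y.
rewrite lee_fin.
have w_sum : 2 * (w * \sum_(i < K.+1) Num.sqrt (1 - (q ^+ i) ^+ 2) ^+ k *
    (q ^+ i - q ^+ i.+1)) <= w'.
  apply: (@omega_ge_sum R n (fun i => q ^+ i)) => i.
  - by rewrite exprn_ge0// ltW.
  - exact: qX_le1.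
  - by rewrite exprS ler_piMl ?exprn_ge0 ?(ltW q0)// ltW.
have := @sum_pieces_le R q e r t (rad / F) C w w' sg rad k K l q0 q1 e0 e1 r0 t0
  C3
  w0 (ltn0Sn n) w_sum l_le.
move=> /le_trans; apply.
have bracket_le (X1 X2 X3 X3' X4 : R) : 0 <= X1 -> 0 <= X2 -> 0 <= X3 ->
    0 <= X4 -> X3 + X4 <= X3' ->
    (r + t) / (1 - e) ^+ k.+1 * (X1 + X2 + X3 + X4) <=
    r * (1 + e) / (1 - e) ^+ k.+1 * (X1 + X2 + X3').
  move=> X10 X20 X30 X40 X34.
  have E0 : 0 < (1 - e) ^+ k.+1 by rewrite exprn_gt0// subr_gt0.
  apply: ler_pM.
  - by rewrite divr_ge0 ?(ltW E0)// addr_ge0 ?ltW.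
  - by rewrite !addr_ge0.
  - by rewrite ler_pM2r ?invr_gt0// mulrDr mulr1 lerD2l mulrC.
  - by rewrite -!addrA !lerD2l.
have C40 : 0 <= C ^+ k * w * (2 / r) / q ^+ k.+2 / (1 - q).
  apply: divr_ge0; last exact: ltW.
  apply: divr_ge0; last by rewrite exprn_ge0// ltW.
  by apply: mulr_ge0; [rewrite mulr_ge0// ltW|rewrite divr_ge0// ltW].
apply: bracket_le.
- apply: mulr_ge0; first by rewrite exprn_ge0// addr_ge0// mulr_ge0// ltW.
  apply: addr_ge0; first by rewrite mulr_ge0// exprn_ge0// ltW.
  apply: mulr_ge0; first by rewrite divr_ge0// exprn_ge0// ltW.
  by rewrite divr_ge0//; exact: (@omega_ge0 R (n + 1)).
- apply: mulr_ge0; last by rewrite exprn_ge0// ltW.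
  apply: divr_ge0; last exact: ltW.
  by apply: divr_ge0; [rewrite mulr_ge0// ltW|rewrite exprn_ge0// ltW].
- by apply: mulr_ge0 => //; apply: addr_ge0; rewrite ?mulr_ge0// ltW.
- apply: mulr_ge0; first by rewrite mulr_ge0// ltW.
  apply: addr_ge0 => //; apply: divr_ge0; last exact: ltW.
  by apply: mulr_ge0; [rewrite mulr_ge0// ltW|exact: sqr_ge0].
rewrite [leRHS]mulrDl mul1r; apply: lerD.
  by rewrite -[leRHS]mulrA ler_wpM2l// mulrDl mul1r lerD2r.
have -> : C ^+ k * (rad / F) * (1 + 2 * t * M ^+ 2 / r) =
    rad * (C ^+ k * (1 + 2 * t * M ^+ 2 / r) / F) by ring.
rewrite ger_pMr// ler_pdivrMr// mul1r /F ler_pM2l// lerD2l ler_pM2r ?invr_gt0//.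
by rewrite ler_wpM2r ?sqr_ge0// ler_pM2l.
Qed.

End local_estimate.

(** * The flatness index *)

Section limits.
Context {R : realType}.
Local Open Scope ereal_scope.

Lemma limf_einf_le {T : choiceType} {X : filteredType T} (F : set_system X)
    (f : X -> \bar R) (c : \bar R) :
  (forall V, F V -> exists2 x, V x & f x <= c) -> limf_einf f F <= c.
Proof.
move=> Fc; rewrite limf_einfE; apply: ge_ereal_sup => _ [V FV <-].
have [x Vx fx] := Fc _ FV.
by apply: le_trans fx; apply: ereal_inf_lbound; exists x.
Qed.

Lemma limf_einf_right_le (f : R -> \bar R) (c C R0 : R) : (0 < R0)%R ->
  (forall rho, (0 < rho < R0)%R -> f rho <= (c + C * rho)%:E) ->
  limf_einf f (0%R : R)^'+ <= c%:E.
Proof.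
move=> R00 fC; apply/lee_addgt0Pr => e e0.
rewrite -EFinD; apply: limf_einf_le => V V0.
have C1 : (0 < `|C| + 1)%R by rewrite ltr_wpDl.
have eC : (0 < e / (`|C| + 1))%R by rewrite divr_gt0.
have /filter_ex[x [Vx x0 xR xe]] : \forall x \near (0%R : R)^'+,
    [/\ V x, (0 < x)%R, (x < R0)%R & (x < e / (`|C| + 1))%R].
  near=> x; split.
  - by near: x.
  - by near: x; exact: nbhs_right_gt.
  - by near: x; exact: nbhs_right_lt.
  - by near: x; exact: nbhs_right_lt.
exists x => //; apply: le_trans (fC x _) _; first by rewrite x0.
rewrite lee_fin lerD2l; move: xe; rewrite ltr_pdivlMr// => /ltW;
  apply: le_trans.
by rewrite mulrC ler_wpM2l ?(ltW x0)// (le_trans (ler_norm _))// lerDl.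
Unshelve. all: by end_near. Qed.

Lemma le_fin_cvg {T} (F : set_system T) {FF : ProperFilter F} (x : \bar R)
    (u : T -> R) (l : R) : u @ F --> l ->
  (\forall t \near F, x <= (u t)%:E) -> x <= l%:E.
Proof.
move=> ul xu; have ul' : (u t)%:E @[t --> F] --> l%:E.
  by apply: cvg_EFin => //; near=> t.
rewrite -(cvg_lim _ ul')//; apply: lime_ge => //.
by apply/cvg_ex; eexists; exact: ul'.
Unshelve. all: by end_near. Qed.

End limits.

Theorem proposition1p5 (R : realType) (m : nat) (hn : (2 <= m + 1)%N)
    (Omega : set 'rV[R]_(m + 1)) (x0 z : 'rV[R]_(m + 1))
    (Omega_open : open Omega) (Omega_bounded : bounded_set Omega)
    (boundary_finite : (hausdorff (m + 1).-1 (boundary Omega) < +oo)%E)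
    (Omega_x0 : Omega x0)
    (touch_z : touching_set (boundary Omega) x0 z)
    (flat_z : lipschitz_flat Omega z) :
  (flatness_index Omega x0 z <= 1)%E.
Proof.
case: m => [|n] in hn Omega x0 z Omega_open Omega_bounded boundary_finite
  Omega_x0 touch_z flat_z *; first by [].
have [rho [a [b [psi [[rho0 zab _] [lip dpsi ae_cvg bdry below]]]]]] := flat_z.
set r := enorm (z - x0); set w := omega R n.+1; set w' := omega R (n.+1 + 1).
set lim_inf := limf_einf (fun rho : R => limf_einf
  (flatness_integral Omega x0 z rho)
  (within (~` closure Omega) (nbhs z))) (0%R)^'+.
have w'0 : 0 <= w' by exact: (@omega_ge0 R (n + 1)).
have r0 : 0 <= r by exact: enorm_ge0.
have lim_K q e : 0 < q < 1 -> 0 < e < 1 -> (lim_inf <=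
    (r * (1 + e) / (1 - e) ^+ n.+2 *
      ((1 + 2 * e) ^+ n.+1 * (n.+2%:R / q ^+ n.+2 * (w' / 2))))%:E)%E.
  move=> q01 e01.
  have [C3 est] := flatness_integral_le rho0 zab lip dpsi ae_cvg bdry below
    Omega_open Omega_x0 touch_z q01 e01.
  set D := r * (1 + e) / (1 - e) ^+ n.+2.
  pose X K := D * ((1 + 2 * e) ^+ n.+1 *
    (w * q ^+ K + n.+2%:R / q ^+ n.+2 * (w' / 2)) + C3 * q ^+ K).
  have limX K : (lim_inf <= (X K)%:E)%E.
    have [C4 [R0 [R00 estK]]] := est K.
    apply: (@limf_einf_right_le _ _ _ (D * C4) R0) => // rad rad0.
    apply: limf_einf_le => V /= nV.
    have [alpha [Valpha out le]] := estK rad rad0 _ nV.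
    exists alpha; first exact: Valpha.
    apply: le_trans le _; rewrite lee_fin -/r -/w -/w' -/D /X.
    by rewrite [leLHS]mulrDr [D * (C4 * rad)]mulrA.
  apply: (@le_fin_cvg _ _ \oo _ _ X); last by near=> K; exact: limX.
  have qK : q ^+ K @[K --> \oo] --> 0.
    by apply: cvg_expr; case/andP: q01 => q0 q1; rewrite gtr0_norm.
  rewrite [X in _ --> X](_ : _ = D * ((1 + 2 * e) ^+ n.+1 *
    (w * 0 + n.+2%:R / q ^+ n.+2 * (w' / 2)) + C3 * 0)); last first.
    by rewrite !mulr0 add0r addr0.
  apply: cvgMr; apply: cvgD; last exact: cvgMr.
  by apply: cvgMr; apply: cvgD; [exact: cvgMr|exact: cvg_cst].
have lim_le : (lim_inf <= (r * n.+2%:R * (w' / 2))%:E)%E.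
  pose Y (e : R) := r * (1 + e) / (1 - e) ^+ n.+2 *
    ((1 + 2 * e) ^+ n.+1 * (n.+2%:R / (1 - e) ^+ n.+2 * (w' / 2))).
  apply: (@le_fin_cvg _ _ (0 : R)^'+ _ _ Y); last first.
    near=> e; have e01 : 0 < e < 1.
      by apply/andP; split; near: e;
        [exact: nbhs_right_gt|exact: nbhs_right_lt].
    apply: lim_K => //; case/andP: e01 => e0 e1.
    by rewrite subr_gt0 e1 gtrBl.
  have cid : e @[e --> (0 : R)^'+] --> (0 : R) by exact: cvg_at_right_filter.
  have pow (f : R -> R) (x : R) i : f e @[e --> (0 : R)^'+] --> x ->
      f e ^+ i @[e --> (0 : R)^'+] --> x ^+ i.
    by move=> fx; exact: (cvg_comp _ _ fx (@exprn_continuous R i x)).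
  have c1e : (1 - e) ^+ n.+2 @[e --> (0 : R)^'+] --> ((1 - 0) ^+ n.+2 : R).
    by apply: pow; apply: cvgB => //; exact: cvg_cst.
  have n1 : (1 - 0 : R) ^+ n.+2 != 0 by rewrite subr0 expr1n oner_neq0.
  rewrite [X in _ --> X](_ : _ = r * (1 + 0) / (1 - 0) ^+ n.+2 *
    ((1 + 2 * 0) ^+ n.+1 * (n.+2%:R / (1 - 0) ^+ n.+2 * (w' / 2)))); last first.
    by rewrite mulr0 !addr0 !subr0 !expr1n !divr1; ring.
  apply: cvgM.
    apply: cvgM; last exact: cvgV.
    by apply: cvgMr; apply: cvgD => //; exact: cvg_cst.
  apply: cvgM.
    by apply: pow; apply: cvgD; [exact: cvg_cst|exact: cvgMr].
  by apply: cvgMl; apply: cvgMr; exact: cvgV.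
rewrite /flatness_index -/r -/w' -/lim_inf.
apply: (@le_trans _ _
    ((2 / ((n.+1 + 1)%:R * w' * r))%:E * (r * n.+2%:R * (w' / 2))%:E)%E).
  by rewrite lee_wpmul2l// lee_fin divr_ge0// !mulr_ge0.
rewrite -EFinM lee_fin addn1.
have [->|rn0] := eqVneq r 0; first by rewrite !mul0r mulr0.
have [->|wn0] := eqVneq w' 0; first by rewrite mul0r !mulr0.
have : (n.+2%:R : R) != 0 by rewrite pnatr_eq0.
move: (n.+2%:R : R) => N N0.
by rewrite le_eqVlt; apply/orP; left; apply/eqP; field; rewrite rn0 wn0 N0.
Unshelve. all: by end_near. Qed.
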